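(* For every (real, grid-based) transseries $A \in \mathbb{T}_{\bullet\bullet}$ there exists a transseries $B \in \mathbb{T}_{\bullet\bullet}$ with $B' = A$.
   Context: **Grid-based series.** Let $\mathfrak M$ be a totally ordered abelian group written multiplicatively with identity $1$ and strict order $\succ$ (''far larger than''); $\mathfrak M^{\mathrm{small}}=\{\mathfrak g: \mathfrak g\prec 1\}$. A ratio set is a finite set $\mu=\{\mu_1,\dots,\mu_n\}\subset\mathfrak M^{\mathrm{small}}$ ($n\ge 1$); $\mu^{k}=\mu_1^{k_1}\cdots\mu_n^{k_n}$ for $k\in\mathbb Z^n$. $\mathbb Z^n$ has the componentwise partial order. For $m\in\mathbb Z^n$ the grid is $\mathfrak J^{\mu,m}=\{\mu^k: k\ge m\}$. For $T:\mathfrak M\to\mathbb R$ write $T[\mathfrak g]$ for its values, $\operatorname{supp}T=\{\mathfrak g: T[\mathfrak g]\ne0\}$, and write $T$ formally as $\sum T[\mathfrak g]\,\mathfrak g$. $\mathbb R[\![\mathfrak M]\!]$ denotes the set of all $T$ whose support is contained in some grid (over all $\mu,m$), with pointwise addition and product $(AB)[\mathfrak g]=\sum_{\mathfrak m\mathfrak n=\mathfrak g}A[\mathfrak m]B[\mathfrak n]$; it is a field. Reals $c$ are identified with $c\cdot 1$, monomials $\mathfrak m$ with the series $1\cdot\mathfrak m$. Supports have a $\succ$-largest element when nonempty: for $T\neq 0$ it is $\operatorname{mag}T$; $T>0$ iff the coefficient of $\operatorname{mag}T$ is positive, and $S>T$ iff $S-T>0$. $T$ is small if all $\mathfrak g\in\operatorname{supp}T$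 satisfy $\mathfrak g\prec1$, large if $\operatorname{mag}T\succ1$, and purely large if all $\mathfrak g\in\operatorname{supp}T$ satisfy $\mathfrak g\succ 1$ ($0$ is purely large). Infinite sums $\sum_i A_i$ mean: all $\operatorname{supp}A_i$ lie in one grid, each monomial lies in only finitely many $\operatorname{supp}A_i$, and coefficients are added monomial by monomial. **Log-free transseries.** $\mathfrak G_0=\{x^b:b\in\mathbb R\}$ with $x^ax^b=x^{a+b}$, $x^a\prec x^b$ iff $a<b$; $\mathbb T_0=\mathbb R[\![\mathfrak G_0]\!]$. Recursively, $\mathfrak G_{N+1}$ is the set of formal symbols $x^be^L$ with $b\in\mathbb R$ and $L\in\mathbb T_N$ purely large, with $(x^{b_1}e^{L_1})(x^{b_2}e^{L_2})=x^{b_1+b_2}e^{L_1+L_2}$ and $x^{b_1}e^{L_1}\succ x^{b_2}e^{L_2}$ iff $L_1>L_2$ or ($L_1=L_2$ and $b_1>b_2$); $\mathbb T_{N+1}=\mathbb R[\![\mathfrak G_{N+1}]\!]$. One identifies $x^b$ with $x^be^0$, so $\mathfrak G_N\subseteq\mathfrak G_{N+1}$, $\mathbb T_N\subseteq\mathbb T_{N+1}$. $\mathfrak G_\bullet=\bigcup_N\mathfrak G_N$, $\mathbb T_\bullet=\bigcup_N\mathbb T_N$. **Derivative on $\mathbb T_\bullet$.** $(x^a)'=ax^{a-1}$, $(x^be^L)'=(bx^{-1}+L')x^be^L$, $\big(\sum a_{\mathfrak g}\mathfrak g\big)'=\sum a_{\mathfrak g}\mathfrak g'$. **Powers, exponential,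 composition.** For $S\in\mathbb T_\bullet$, $S>0$, $b\in\mathbb R$: write uniquely $S=c\,x^ae^L(1+U)$ with $c>0$ real, $x^ae^L\in\mathfrak G_\bullet$, $U$ small, and put $S^b=c^bx^{ab}e^{bL}\sum_{j\ge0}\binom bj U^j$. For $S\in\mathbb T_\bullet$: write uniquely $S=L+c+U$ with $L$ purely large, $c\in\mathbb R$, $U$ small, and put $e^S=e^c\,e^L\sum_{j\ge0}U^j/j!$, where $e^L=x^0e^L\in\mathfrak G_\bullet$. For $S\in\mathbb T_\bullet$ large and positive, composition is defined recursively by $(x^be^L)\circ S=S^b\,e^{L\circ S}$ and $\big(\sum c_{\mathfrak g}\mathfrak g\big)\circ S=\sum c_{\mathfrak g}(\mathfrak g\circ S)$. In particular $T\circ\exp:=T\circ e^x$. **Transseries with logarithms.** For $M\in\mathbb N=\{0,1,2,\dots\}$, a transseries of depth $M$ is a formal expression $T\circ\log_M$ with $T\in\mathbb T_\bullet$ ($\log_M$ is the $M$-fold iterate of $\log$, $\log_0x=x$); $\mathbb T_{\bullet M}$ is the set of these. $T\circ\log_M$ is identified with $(T\circ\exp)\circ\log_{M+1}$, so $\mathbb T_{\bullet M}\subseteq\mathbb T_{\bullet,M+1}$. The field of (real, grid-based) transseries is $\mathbb T_{\bullet\bullet}=\bigcup_{M}\mathbb T_{\bullet M}$; the operations are transported from $\mathbb T_\bullet$ (e.g. $T_1\circ\log_M+T_2\circ\log_M=(T_1+T_2)\circ\log_M$, and similarly for products). The derivative is determined by $(T\circ\log)'=(T'\circ\log)\cdot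 x^{-1}=(T'e^{-x})\circ\log$, iterated: $(T\circ\log_M)'=(T'\circ\log_M)\cdot\big(\prod_{m=0}^{M-1}\log_m x\big)^{-1}$. *)

(* Defs.v *)
From HB Require Import structures.
From mathcomp Require Import all_boot all_order all_algebra.
From mathcomp Require Import all_classical all_reals all_analysis.

Set Implicit Arguments.
Unset Strict Implicit.
Unset Printing Implicit Defensive.
Import Order.TTheory GRing.Theory Num.Theory.

Local Open Scope classical_set_scope.
Local Open Scope ring_scope.

(* Grid-based transseries over the real field R.

   The monomial x^b e^L is encoded by its exponent (b, L).  Monomial groups are
   therefore written additively: the product of monomials is [+], the identity
   monomial 1 is [0], the inverse is [-], and the real power m^b is [b *: m].

   A series T = sum T[g] g is the function g |-> T[g], so for series [+] and
   [*:] are the coefficientwise operations; their product is [smul].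

   The monomial group is the subset [mmem] of [mcarrier], and R[[M]] is the set
   of [grid_based] series, whose supports lie in [mmem].  The operations are
   total on arbitrary functions; their values matter on grid-based series only. *)

Section Series.
Variable R : realType.

Record monomials := Monomials {
  mcarrier :> lmodType R;
  mlt : mcarrier -> mcarrier -> Prop;
  mmem : mcarrier -> Prop }.

Definition gseries (M : monomials) := M -> R^o.

Section Generic.
Variable M : monomials.
Implicit Types (S T U : gseries M) (g h : M).

Definition mono g : gseries M := fun h => (h == g)%:R.

(* The support of T lies in the grid {mu^k : k >= m} of the ratio set
   {mu_0, ..., mu_n}; repetitions among the mu_i yield no further grids. *)
Definition grid_based T : Prop :=
  exists (n : nat) (mu : 'I_n.+1 -> M) (m : 'I_n.+1 -> int),
    (forall i, mmem (mu i) /\ mlt (mu i) 0) /\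
    (forall g, T g != 0 ->
       exists k : 'I_n.+1 -> int,
         (forall i, m i <= k i) /\ g = \sum_i mu i *~ k i).

Definition is_mag T g : Prop :=
  T g != 0 /\ (forall h, T h != 0 -> h <> g -> mlt h g).

Definition spos T : Prop := exists g, is_mag T g /\ 0 < T g.

Definition small T : Prop := forall g, T g != 0 -> mlt g 0.
Definition purely_large T : Prop := forall g, T g != 0 -> mlt 0 g.

(* The pairs (m, n) with m n = g are the pairs (m, g / m). *)
Definition smul S T : gseries M :=
  fun g => \sum_(m \in [set: M]) S m * T (g - m).

Definition sexpn T (j : nat) : gseries M := iter j (smul T) (mono 0).

End Generic.

(* \sum_(i \in _) sums families of finite support (and is 0 otherwise).  The
   families summed below are supported in a common grid, with each monomial in
   finitely many supports, when they are built from grid-based series. *)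
Definition ssum (I : choiceType) (M : monomials) (F : I -> gseries M) :
    gseries M :=
  fun g => \sum_(i \in [set: I]) F i g.

(* The strongly linear extension of F: T is mapped to sum T[g] F(g). *)
Definition sext (M M' : monomials) (F : M -> gseries M') (T : gseries M) :
    gseries M' :=
  ssum (fun g : M => T g *: F g).

(* G_0 = {x^b}, with x^b encoded by b. *)
Definition powers_of_x : monomials :=
  @Monomials R^o (fun a b : R => a < b) (fun=> True).

(* From G_N to G_{N+1} = {x^b e^L : b real, L purely large in R[[G_N]]}. *)
Definition exp_extension (M : monomials) : monomials :=
  @Monomials (R^o * (M -> R^o))%type
    (fun g h => spos (h.2 - g.2) \/ (g.2 = h.2 /\ (g.1 : R) < h.1))
    (fun g => grid_based g.2 /\ purely_large g.2).

Fixpoint G (N : nat) : monomials :=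
  if N is N'.+1 then exp_extension (G N') else powers_of_x.

(* x^b in G_N. *)
Definition xpow (N : nat) : R -> G N :=
  if N is N'.+1 return R -> G N then fun b => (b, 0) else fun b => b.

(* e^L in G_{N+1}. *)
Definition emon (N : nat) (L : gseries (G N)) : G N.+1 := (0, L).

(* The inclusions of G_N in G_{N+1} and of T_N in T_{N+1}. *)
Fixpoint embG (N : nat) : G N -> G N.+1 :=
  if N is N'.+1 return G N -> G N.+1
  then fun g => (g.1, sext (fun h => mono (embG h)) g.2)
  else fun b => (b, 0).

Definition emb (N : nat) : gseries (G N) -> gseries (G N.+1) :=
  sext (fun h => mono (embG h)).

Fixpoint embn (n N : nat) (T : gseries (G N)) : gseries (G (n + N)) :=
  if n is n'.+1 return gseries (G (n + N)) then emb (@embn n' N T) else T.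

Fixpoint derivG (N : nat) : G N -> gseries (G N) :=
  if N is N'.+1 return G N -> gseries (G N)
  then fun g => smul (g.1 *: mono (xpow N'.+1 (-1)) +
                      emb (sext (@derivG N') g.2))
                     (mono g)
  else fun a => a *: mono (xpow 0 ((a : R) - 1)).

Definition sderiv (N : nat) : gseries (G N) -> gseries (G N) :=
  sext (@derivG N).

Definition gbinom (b : R) (j : nat) : R :=
  (\prod_(i < j) (b - i%:R)) / j`!%:R.

(* S^b, from the unique writing S = c g (1 + U), c > 0, of a series S > 0;
   meaningless when S > 0 fails. *)
Definition spow (M : monomials) (S : gseries M) (b : R) : gseries M :=
  let: (c, g, U) :=
    xget ((0, 0, 0) : R * M * gseries M)
      [set p | [/\ 0 < p.1.1, small p.2 &
         S = (p.1.1 : R) *: smul (mono p.1.2) (mono 0 + p.2)]] in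
  (c `^ b : R) *:
    smul (mono (b *: g)) (ssum (fun j => gbinom b j *: sexpn U j)).

(* e^S, from the unique writing S = L + c + U. *)
Definition sexp (N : nat) (S : gseries (G N)) : gseries (G N.+1) :=
  let: (L, c, U) :=
    xget ((0, 0, 0) : gseries (G N) * R * gseries (G N))
      [set p | [/\ purely_large p.1.1, small p.2 &
         S = p.1.1 + (p.1.2 : R) *: mono 0 + p.2]] in
  (expR c : R) *:
    smul (mono (emon L))
         (emb (ssum (fun j => (j`!%:R^-1 : R) *: sexpn U j))).

(* g o S for g in G_N and S in T_K large and positive.  It lies in T_{N+K}, as
   e^{L o S} does when L o S lies in T_{N-1+K}. *)
Fixpoint compG (K : nat) (S : gseries (G K)) (N : nat) :
    G N -> gseries (G (N + K)) :=
  if N is N'.+1 return G N -> gseries (G (N + K))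
  then fun g => smul (@embn N'.+1 K (spow S g.1)) (sexp (sext (@compG K S N') g.2))
  else fun b => spow S b.

Definition scomp (N K : nat) (T : gseries (G N)) (S : gseries (G K)) :
    gseries (G (N + K)) :=
  sext (@compG K S N) T.

Definition sx (N : nat) : gseries (G N) := mono (xpow N 1).

Definition comp_exp (N : nat) (T : gseries (G N)) : gseries (G (N + 1)) :=
  scomp T (sexp (@sx 0)).

(* The formal expression T o log_M, with T a series over G_N. *)
Record texpr := TExpr {
  depth : nat;
  height : nat;
  body : gseries (G height) }.

Definition transseries (A : texpr) : Prop := grid_based (@body A).

(* Equality of transseries is generated by the identification of T in T_N with
   its image in T_{N+1} and of T o log_M with (T o exp) o log_{M+1}. *)
Inductive teq : texpr -> texpr -> Prop :=
| teq_refl A : teq A A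
| teq_sym A B : teq A B -> teq B A
| teq_trans A B C : teq A B -> teq B C -> teq A C
| teq_emb M N (T : gseries (G N)) :
    grid_based T -> teq (TExpr M T) (TExpr M (emb T))
| teq_exp M N (T : gseries (G N)) :
    grid_based T -> teq (TExpr M T) (TExpr M.+1 (comp_exp T)).

(* The M-fold iterated exponential of x, in T_{M+N}. *)
Fixpoint expn_x (N M : nat) : gseries (G (M + N)) :=
  if M is M'.+1 return gseries (G (M + N)) then sexp (@expn_x N M') else @sx N.

(* If (T o log_M)' = D o log_M, then e^{-x} = e^{-exp_M} o log_M gives
   (T o log_{M+1})' = ((T o log_M)' e^{-x}) o log
                    = (D e^{-exp_M}) o log_{M+1}. *)
Fixpoint deriv_log (N M : nat) (T : gseries (G N)) : gseries (G (M + N)) :=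
  if M is M'.+1 return gseries (G (M + N))
  then smul (emb (@deriv_log N M' T)) (sexp (- @expn_x N M'))
  else sderiv T.

Definition tderiv (A : texpr) : texpr :=
  TExpr (depth A) (@deriv_log (height A) (depth A) (@body A)).

End Series.

Arguments xpow {R} N _.
Arguments sx {R} N _.
Arguments body {R} t _.
Arguments expn_x {R} N M _.
Arguments deriv_log {R} N M T _.

(* Main.v *)
Require Import Defs.
From Stdlib Require List.
From mathcomp Require Import all_boot all_order all_algebra.
From mathcomp Require Import all_classical all_reals all_analysis.
From mathcomp Require Import ring.

Set Implicit Arguments.
Unset Strict Implicit.
Unset Printing Implicit Defensive.
Import Order.TTheory GRing.Theory Num.Theory.

Local Open Scope classical_set_scope.
Local Open Scope ring_scope.

(** Integration reduces to log-free transseries. Composing with [exp] and raising the depth by one turns every monomial into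
    an exponential [e^L] without a power of [x] ([comp_expE], [xdeg_compE]).
    The derivative of [S o log_n] is [S' / (exp_1 x ... exp_n x)] composed with
    [log_n] ([deriv_log_expG]), so one has to solve [S' = W], where [W] is the
    given series times a product of iterated exponentials. No monomial of [W]
    contains a power of [x]; in particular [x^-1], the only obstruction to
    log-free integration, is absent.

    To solve [S' = W] ([integral_exists]), write [psi g = x g' / g] for the
    logarithmic derivative of a monomial [g] with respect to [x d/dx].  Three
    facts are used.  Firstly, [psi] is a morphism from monomials to series.
    Secondly, for [g] large the monomials of [psi g] lie between 1 and [g]: the
    logarithm of a large monomial is less than any power of it ([log_small]).
    On the monomials [g] other than 1, this makes [g |-> mag (x g')] a strictly
    increasing map ([psi_dominant]), which never takes the value 1 and attains
    every other monomial [h], at [h / mag (psi h)].  Comparing the coefficients of [x S'] and [x W] at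
    [mag (x g')] therefore gives a triangular system for the coefficients of
    [S], which is solved from the largest monomial downwards
    ([triangular_solution]).

    Thirdly, there is a finiteness property ([ld_span]), which keeps the
    solution in a grid: the monomials of a grid lie in a group whose
    logarithmic derivatives span a finite-dimensional space of series with
    monomials in the same group. Only finitely many magnitudes [m] occur in such
    a space ([span_mags]), so the ratios [q / m] of the other monomials of [psi g]
    to its magnitude lie in one grid; being small, they are products of elements
    of a finite set of small monomials ([gset_small], a consequence of Dickson's
    lemma), which is adjoined to the ratio set of [W].

    The three facts are proved by induction on the height
    ([log_derivation_step]), since [psi (x^b e^L) = b + x L'] with [L] of
    smaller height.

    Both the inclusion of a level in the next one and the composition with [exp]
    are induced by an order embedding of monomials; all products that occur have
    a monomial as a factor, hence are translations of coefficients. *)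

(** * Identities in abelian groups *)

Inductive zexp := ZVar of nat | ZZero | ZAdd of zexp & zexp | ZOpp of zexp.

Fixpoint zeval (V : zmodType) (env : seq V) (t : zexp) : V :=
  match t with
  | ZVar i => env`_i
  | ZZero => 0
  | ZAdd t u => zeval env t + zeval env u
  | ZOpp t => - zeval env t
  end.

Fixpoint zcoef (t : zexp) (i : nat) : int :=
  match t with
  | ZVar j => (j == i)%:R
  | ZZero => 0
  | ZAdd t u => zcoef t i + zcoef u i
  | ZOpp t => - zcoef t i
  end.

Lemma zevalE (V : zmodType) (env : seq V) t :
  zeval env t = \sum_(i < size env) env`_i *~ zcoef t i.
Proof.
elim: t => [j||t IHt u IHu|t IHt] /=.
- have [le_j|lt_j] := leqP (size env) j.
    rewrite nth_default // big1 // => i _.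
    by rewrite gtn_eqF ?mulr0z // (leq_trans (ltn_ord i)).
  rewrite (bigD1 (Ordinal lt_j)) //= eqxx big1 ?addr0 // => i ne_ij.
  by case: eqP => [ji|_]; rewrite ?mulr0z //; case/eqP: ne_ij; apply: val_inj.
- by rewrite big1 // => i _; rewrite mulr0z.
- by rewrite IHt IHu -big_split; apply: eq_bigr => i _; rewrite mulrzDr.
- by rewrite IHt -sumrN; apply: eq_bigr => i _; rewrite mulrNz.
Qed.

Lemma zeval_eq (V : zmodType) (env : seq V) t u :
  all (fun i => zcoef t i == zcoef u i) (iota 0 (size env)) ->
  zeval env t = zeval env u.
Proof.
move=> /allP tu; rewrite !zevalE; apply: eq_bigr => i _.
by rewrite (eqP (tu i _)) // mem_iota add0n ltn_ord.
Qed.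

Ltac zindex x env :=
  lazymatch env with
  | x :: _ => constr:(0%N)
  | _ :: ?e => let i := zindex x e in constr:(i.+1)
  end.
Ltac zadd x env :=
  match env with
  | _ => let _ := zindex x env in env
  | _ => constr:(x :: env)
  end.
Ltac zatoms t env :=
  lazymatch t with
  | (?a + ?b)%R => let e := zatoms a env in zatoms b e
  | (- ?a)%R => zatoms a env
  | 0%R => env
  | _ => zadd t env
  end.
Ltac zreify t env :=
  lazymatch t with
  | (?a + ?b)%R =>
      let u := zreify a env in let v := zreify b env in constr:(ZAdd u v)
  | (- ?a)%R => let u := zreify a env in constr:(ZOpp u)
  | 0%R => constr:(ZZero)
  | _ => let i := zindex t env in constr:(ZVar i)
  end.
(** Monomial groups are additive and have no ring structure, so identities
    between monomials are decided by comparing the integer coefficients of the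
    atoms on both sides. *)
Ltac abel :=
  match goal with
  | |- @eq ?V ?a ?b =>
      let e0 := zatoms a (@nil V) in let e := zatoms b e0 in
      let t := zreify a e in let u := zreify b e in
      apply: (@zeval_eq _ e t u); vm_compute; reflexivity
  end.

(** * Finite sums *)

Section FiniteSums.
Variables (R : realType) (I : choiceType).
Implicit Types f g : I -> R^o.

Lemma fsum_neq0 f :
  \sum_(i \in [set: I]) f i != 0 -> exists i, f i != 0.
Proof.
by move=> /eqP s0; apply: contra_notP s0 => /forallNP f0; apply: fsbig1 => i _;
   apply/eqP/negPn/negP/f0.
Qed.

Lemma fsumD f g : finite_set [set i | f i != 0] -> finite_set [set i | g i != 0] ->
  \sum_(i \in [set: I]) (f i + g i) =
  \sum_(i \in [set: I]) f i + \sum_(i \in [set: I]) g i.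
Proof.
move=> fin_f fin_g; set P := [set i | f i != 0] `|` [set i | g i != 0].
have sum_P (h : I -> R^o) : (forall i, ~ P i -> h i = 0) ->
    \sum_(i \in [set: I]) h i = \sum_(i \in P) h i.
  by move=> h0; rewrite (fsbig_widen P setT h) // => i [_ /h0].
have f0 i : ~ P i -> f i = 0.
  by move=> nPi; apply/eqP/negPn/negP => fi; apply: nPi; left.
have g0 i : ~ P i -> g i = 0.
  by move=> nPi; apply/eqP/negPn/negP => gi; apply: nPi; right.
rewrite !sum_P // ?fsbig_split ?finite_setU // => i nPi.
by rewrite f0 ?g0 ?addr0.
Qed.

Lemma fsum_single f i0 : (forall i, i != i0 -> f i = 0) ->
  \sum_(i \in [set: I]) f i = f i0.
Proof.
move=> f0; rewrite -(fsbig_widen [set i0] setT f) ?fsbig_set1 // => i [_ ni].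
by apply: f0; apply/eqP => ii0; apply: ni.
Qed.

End FiniteSums.

Lemma fsum_image (R : realType) (I J : choiceType) (f : I -> J) (P : set I)
    (F : J -> R^o) (H : I -> R^o) :
  (forall h h', P h -> P h' -> f h = f h' -> h = h') ->
  (forall k, F k != 0 -> exists2 h, P h & k = f h) ->
  (forall h, P h -> F (f h) = H h) -> (forall h, ~ P h -> H h = 0) ->
  \sum_(k \in [set: J]) F k = \sum_(h \in [set: I]) H h.
Proof.
move=> injf FP FH H0.
rewrite -(fsbig_widen P setT H) // => [|h [_ /H0] //].
rewrite -(fsbig_widen (f @` P) setT F) // => [|k [_ nk]]; last first.
  by apply/eqP/negPn/negP => /FP[h Ph kE]; apply: nk; exists h.
rewrite fsbig_image; first by apply: eq_fsbigr => h /[!inE] /FH.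
by move=> h h' /[!inE] Ph Ph'; apply: injf.
Qed.

(** * Dickson's lemma *)

(** Induction on the number [n] of coordinates: with [F] dominating [A] in the
    first [n] of them, the elements of [A] not above a member of [F] have a
    last coordinate below a bound [C], hence fall into finitely many slices in
    which only the first [n] coordinates matter. *)
Lemma dickson n (A : (nat -> nat) -> Prop) :
  exists F : seq (nat -> nat), (forall f, List.In f F -> A f) /\
    forall k, A k -> exists2 f, List.In f F & forall i, (i < n)%N -> (f i <= k i)%N.
Proof.
elim: n A => [|n IHn] A.
  have [[k Ak]|noA] := pselect (exists k, A k).
    by exists [:: k]; split=> [f [<-|//]|k' _] //; exists k; first by left.
  by exists [::]; split=> // k Ak; case: noA; exists k.
have [F [FA domF]] := IHn A.
have [C ltC] : exists C, forall f, List.In f F -> (f n <= C)%N.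
  elim: (F) => [|f F' [C ltC]]; first by exists 0%N.
  exists (maxn (f n) C) => f' [<-|/ltC leC]; first exact: leq_maxl.
  exact: leq_trans leC (leq_maxr _ _).
have [H [HA domH]] : exists H : seq (nat -> nat),
    (forall f, List.In f H -> A f) /\ forall k, A k -> (k n < C)%N ->
    exists2 f, List.In f H & forall i, (i < n.+1)%N -> (f i <= k i)%N.
  elim: (C) => [|c [H [HA domH]]]; first by exists [::].
  have [Fc [FcA domFc]] := IHn (fun k => A k /\ k n = c).
  exists (Fc ++ H); split=> [f /List.in_app_iff[/FcA[]|/HA]|k Ak] //.
  rewrite ltnS leq_eqVlt => /orP[/eqP knc|/(domH k Ak)[f Hf lef]]; last first.
    by exists f => //; apply/List.in_app_iff; right.
  have [f Ff lef] := domFc k (conj Ak knc).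
  exists f; first by apply/List.in_app_iff; left.
  move=> i; rewrite ltnS leq_eqVlt => /orP[/eqP->|/lef //].
  by rewrite knc (FcA _ Ff).2.
exists (F ++ H); split=> [f /List.in_app_iff[/FA|/HA]|k Ak] //.
have [leC|/(domH k Ak)[f Hf lef]] := leqP C (k n); last first.
  by exists f => //; apply/List.in_app_iff; right.
have [f Ff lef] := domF k Ak; exists f; first by apply/List.in_app_iff; left.
move=> i; rewrite ltnS leq_eqVlt => /orP[/eqP->|/lef //].
exact: leq_trans (ltC f Ff) leC.
Qed.

Section SeriesOperations.
Variables (R : realType) (M : monomials R).
Implicit Types (S T : gseries M) (g : M).

Lemma serD S T g : (S + T) g = (S g : R) + T g. Proof. by []. Qed.
Lemma serN T g : (- T) g = - (T g : R). Proof. by []. Qed.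
Lemma serZ c T g : (c *: T) g = (c : R) * T g. Proof. by []. Qed.
Definition serE := (serD, serN, serZ).

End SeriesOperations.

(** * Ordered monomial groups *)

(** The monomials form a nontrivial totally ordered group.  The inequality is
    required to be a matter of differences, and asymmetric, even outside
    [mmem], as uniqueness of the decompositions defining powers and
    exponentials has to hold among arbitrary functions. *)
Record ordered_monomials (R : realType) (M : monomials R) : Prop := {
  om_lt : forall g h : M, mlt g h <-> mlt 0 (h - g);
  om_asym : forall g : M, mlt 0 g -> ~ mlt 0 (- g);
  om_mem0 : mmem (0 : M);
  om_memB : forall g h : M, mmem g -> mmem h -> mmem (g - h);
  om_posD : forall g h : M, mmem g -> mmem h ->
    mlt 0 g -> mlt 0 h -> mlt 0 (g + h);
  om_total : forall g : M, mmem g -> [\/ g = 0, mlt 0 g | mlt 0 (- g)];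
  om_nontrivial : exists2 g : M, mmem g & mlt 0 g }.

Section OrderedMonomials.
Variables (R : realType) (M : monomials R).
Hypothesis OM : ordered_monomials M.
Implicit Types (a b e g h x y : M) (s t u : seq M) (X Y : M -> Prop).

Lemma pos0F : ~ mlt (0 : M) 0.
Proof. by move=> p; apply: (om_asym OM p); rewrite oppr0. Qed.

Lemma pos_sub g h : mlt g h -> mlt 0 (h - g). Proof. exact: (om_lt OM g h).1. Qed.
Lemma sub_pos g h : mlt 0 (h - g) -> mlt g h. Proof. exact: (om_lt OM g h).2. Qed.

Lemma mltxx g : ~ mlt g g.
Proof. by move/pos_sub; rewrite subrr; apply: pos0F. Qed.

Lemma mlt_asym g h : mlt g h -> ~ mlt h g.
Proof.
by move=> /pos_sub gh /pos_sub; rewrite -opprB; apply: om_asym gh.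
Qed.

Lemma neg_opp g : mlt g 0 <-> mlt 0 (- g).
Proof. by split=> [/pos_sub|p]; [rewrite sub0r|apply: sub_pos; rewrite sub0r]. Qed.

Lemma memN g : mmem g -> mmem (- g).
Proof. by move=> mg; rewrite -sub0r; exact: (om_memB OM (om_mem0 OM) mg). Qed.

Lemma memD g h : mmem g -> mmem h -> mmem (g + h).
Proof. by move=> mg mh; rewrite -[h]opprK; apply: (om_memB OM) => //; apply: memN. Qed.

Lemma memMn g n : mmem g -> mmem (g *+ n).
Proof.
move=> mg; elim: n => [|n IHn]; rewrite ?mulr0n ?mulrS; last exact: memD.
exact: om_mem0 OM.
Qed.

Lemma memMz g k : mmem g -> mmem (g *~ k).
Proof. by case: k => n mg; [|apply: memN]; apply: memMn. Qed.

Lemma mem_sum I (r : seq I) (F : I -> M) :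
  (forall i, mmem (F i)) -> mmem (\sum_(i <- r) F i).
Proof. by move=> mF; elim/big_ind: _ => //; [apply: om_mem0 OM|exact: memD]. Qed.

Lemma mlt_trans g h x : mmem g -> mmem h -> mmem x ->
  mlt g h -> mlt h x -> mlt g x.
Proof.
move=> mg mh mx /pos_sub gh /pos_sub hx; apply: sub_pos.
have -> : x - g = (x - h) + (h - g) by abel.
by apply: (om_posD OM) => //; apply: (om_memB OM).
Qed.

Lemma mlt_total g h : mmem g -> mmem h -> [\/ g = h, mlt g h | mlt h g].
Proof.
move=> mg mh; case: (om_total OM (om_memB OM mh mg)) => [/eqP|gh|hg].
- by rewrite subr_eq0 => /eqP ->; constructor 1.
- by constructor 2; apply: sub_pos.
- by constructor 3; apply: sub_pos; rewrite -opprB.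
Qed.

Lemma pos_neq0 g : mlt 0 g -> g != 0.
Proof. by move=> p; apply/eqP => g0; apply: pos0F; rewrite -{2}g0. Qed.

Lemma posMn g n : mmem g -> mlt 0 g -> mlt 0 (g *+ n.+1).
Proof.
move=> mg pg; elim: n => [|n IHn]; first by rewrite mulr1n.
by rewrite mulrS; apply: (om_posD OM) => //; apply: memMn.
Qed.

(** * Grids *)

Definition mem_small s := forall x, x \in s -> mmem x /\ mlt x 0.

Definition comb s (k : nat -> nat) : M := \sum_(i < size s) s`_i *+ k i.

Definition monoid s g := exists k, g = comb s k.

(** The sets of monomials contained in a grid, [a] being the monomial
    [mu ^ m] and [s] the ratio set. *)
Definition gset X := exists a s, [/\ mmem a, mem_small s &
  forall g, X g -> exists2 t, monoid s t & g = a + t].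

Lemma monoid0 s : monoid s 0.
Proof. by exists (fun=> 0%N); rewrite /comb big1. Qed.

Lemma monoid_mem s x : x \in s -> monoid s x.
Proof.
move=> sx; exists (fun i => (i == index x s)%N); rewrite /comb.
have lt_i : (index x s < size s)%N by rewrite index_mem.
rewrite (bigD1 (Ordinal lt_i)) //= eqxx nth_index // big1 ?addr0 ?mulr1n // => i ni.
by case: eqP => // ii; case/eqP: ni; apply: val_inj.
Qed.

Lemma monoidD s g h : monoid s g -> monoid s h -> monoid s (g + h).
Proof.
move=> [k ->] [l ->]; exists (fun i => (k i + l i)%N).
by rewrite /comb -big_split; apply: eq_bigr => i _; rewrite mulrnDr.
Qed.

Lemma monoid_sub s t g :
  (forall x, x \in s -> monoid t x) -> monoid s g -> monoid t g.
Proof.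
move=> st [k ->]; rewrite /comb; elim/big_ind: _ => [||i _]; first exact: monoid0.
  exact: monoidD.
elim: (k i) => [|n IHn]; rewrite ?mulr0n ?mulrS; first exact: monoid0.
by apply: monoidD => //; apply: st; rewrite mem_nth.
Qed.

Lemma comb_mem s k : mem_small s -> mmem (comb s k).
Proof. by move=> ss; apply: mem_sum => i; apply/memMn/(ss _ _).1/mem_nth. Qed.

Lemma comb_le0 s k : mem_small s -> comb s k = 0 \/ mlt (comb s k) 0.
Proof.
move=> ss; have mk i : mmem (s`_(i : 'I_(size s)) *+ k i).
  exact/memMn/(ss _ _).1/mem_nth.
suff [] : mmem (comb s k) /\ (comb s k = 0 \/ mlt (comb s k) 0) by [].
rewrite /comb; elim/big_ind: _ => [||i _].
- by split; [exact: om_mem0 OM|left].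
- move=> x y [mx x0] [my y0]; split; first exact: memD.
  case: x0 y0 => [->|x0] [->|y0]; rewrite ?add0r ?addr0; auto.
  right; apply/neg_opp; rewrite opprD.
  by apply: (om_posD OM); try exact: memN; apply/neg_opp.
- split=> //; case: (k i) => [|n]; first by left; rewrite mulr0n.
  have [mi /neg_opp i0] := ss _ (mem_nth 0 (ltn_ord i)).
  by right; apply/neg_opp; rewrite -mulNrn; apply: posMn => //; apply: memN.
Qed.

Lemma combB s k l : (forall i, (i < size s)%N -> (l i <= k i)%N) ->
  comb s k = comb s l + comb s (fun i => k i - l i)%N.
Proof.
move=> lk; rewrite /comb -big_split; apply: eq_bigr => i _ /=.
by rewrite -mulrnDr subnKC // lk.
Qed.

Lemma mem_small_cat s t : mem_small s -> mem_small t -> mem_small (s ++ t).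
Proof. by move=> ss st x; rewrite mem_cat => /orP[/ss|/st]. Qed.

Lemma gset_mem X g : gset X -> X g -> mmem g.
Proof.
move=> [a [s [ma ss Xs]]] /Xs[_ [k ->] ->]; apply: memD => //.
exact: comb_mem.
Qed.

Lemma gset_sub X Y : (forall g, X g -> Y g) -> gset Y -> gset X.
Proof. by move=> XY [a [s [ma ss Ys]]]; exists a, s; split=> // g /XY/Ys. Qed.

Lemma gset0 : gset (fun=> False).
Proof. by exists 0, [::]; split=> //; apply: om_mem0 OM. Qed.

Lemma gset1 a : mmem a -> gset (eq a).
Proof.
move=> ma; exists a, [::]; split=> // _ <-.
by exists 0; [exact: monoid0|rewrite addr0].
Qed.

(** Both grids are contained in one that starts at the larger of the two
    corners, the ratio of the corners being adjoined to the ratio sets. *)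
Lemma gsetU X Y : gset X -> gset Y -> gset (fun g => X g \/ Y g).
Proof.
move=> [a [s [ma ss Xs]]] [b [t [mb st Yt]]].
have [e [v [me sv [va vb]]]] : exists e v, [/\ mmem e, mem_small v &
    monoid v (a - e) /\ monoid v (b - e)].
  have mono1 x : monoid [:: x] x by apply: monoid_mem; rewrite inE.
  have small1 x y : mmem x -> mmem y -> mlt x y -> mem_small [:: x - y].
    move=> mx my xy z; rewrite inE => /eqP ->; split; first exact: (om_memB OM mx my).
    by apply/neg_opp; rewrite opprB; apply: pos_sub.
  case: (mlt_total ma mb) => [<-|ab|ba].
  - by exists a, [::]; rewrite subrr; split=> //; split; exact: monoid0.
  - exists b, [:: a - b]; rewrite subrr; split=> //; first exact: small1.
    by split=> //; exact: monoid0.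
  - exists a, [:: b - a]; rewrite subrr; split=> //; first exact: small1.
    by split=> //; exact: monoid0.
have sub w x : (forall y, y \in w -> y \in v ++ s ++ t) -> monoid w x ->
    monoid (v ++ s ++ t) x.
  by move=> wv; apply: monoid_sub => y /wv; apply: monoid_mem.
exists e, (v ++ s ++ t); split=> //; first by do 2!apply: mem_small_cat => //.
move=> g [/Xs[x sx ->]|/Yt[x tx ->]].
  exists (a - e + x); last by abel.
  apply: monoidD; [apply: sub va|apply: sub sx] => y yw.
    by rewrite mem_cat yw.
  by rewrite !mem_cat yw orbT.
exists (b - e + x); last by abel.
apply: monoidD; [apply: sub vb|apply: sub tx] => y yw.
  by rewrite mem_cat yw.
by rewrite !mem_cat yw !orbT.
Qed.

Lemma gset_seq s : (forall x, x \in s -> mmem x) -> gset (fun g => g \in s).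
Proof.
elim: s => [|x s IHs] ms; first exact: gset_sub gset0.
have gs : gset (fun g => g \in s) by apply: IHs => y sy; apply: ms; rewrite inE sy orbT.
apply: gset_sub (gsetU (gset1 (ms x (mem_head _ _))) gs) => g.
by rewrite inE => /orP[/eqP->|]; auto.
Qed.

Lemma gsetD X Y : gset X -> gset Y ->
  gset (fun g => exists x y, [/\ X x, Y y & g = x + y]).
Proof.
move=> [a [s [ma ss Xs]]] [b [t [mb st Yt]]].
exists (a + b), (s ++ t); split; [exact: memD|exact: mem_small_cat|].
move=> _ [_ [_ [/Xs[x sx ->] /Yt[y ty ->] ->]]].
exists (x + y); last by abel.
apply: monoidD; [apply: monoid_sub sx|apply: monoid_sub ty] => z zw;
  by apply: monoid_mem; rewrite mem_cat zw ?orbT.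
Qed.

Lemma gset_shift X a : gset X -> mmem a -> gset (fun g => X (g - a)).
Proof.
move=> gX ma; apply: gset_sub (gsetD gX (gset1 ma)) => g Xg.
by exists (g - a), a; split=> //; abel.
Qed.

Lemma list_max s : (forall x, x \in s -> mmem x) -> s != [::] ->
  exists2 m, m \in s & forall x, x \in s -> x = m \/ mlt x m.
Proof.
elim: s => // x [|y s] IHs mxs _.
  by exists x; rewrite ?inE // => y; rewrite inE => /eqP; left.
have ms z : z \in y :: s -> mmem z by move=> sz; apply: mxs; rewrite inE sz orbT.
have mx : mmem x by apply: mxs; rewrite mem_head.
have [//|m sm lem] := IHs ms _.
have := mlt_total mx (ms m sm); case=> xm; [exists m|exists m|exists x].
- by rewrite inE sm orbT.
- by move=> z; rewrite inE => /orP[/eqP->|/lem]; auto.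
- by rewrite inE sm orbT.
- by move=> z; rewrite inE => /orP[/eqP->|/lem]; auto.
- by rewrite mem_head.
- move=> z; rewrite inE => /orP[/eqP->|sz]; auto.
  case: (lem z sz) => [->|zm]; auto.
  by right; apply: mlt_trans zm xm => //; apply: ms.
Qed.

Lemma gset_dickson X : gset X -> exists s t, [/\ mem_small s,
  (forall x, x \in t -> X x) &
  forall x, X x -> exists2 y, y \in t & monoid s (x - y)].
Proof.
move=> [a [s [ma ss Xs]]].
have [F [FX domF]] := dickson (size s) (fun k => X (a + comb s k)).
exists s, [seq a + comb s f | f <- F]; split=> // [x|x Xx].
  elim: F FX {domF} => // f F IHF FX; rewrite inE => /orP[/eqP->|].
    by apply: FX; left.
  by apply: IHF => f' Ff'; apply: FX; right.
have [_ [k ->] xE] := Xs x Xx.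
have [|f Ff lef] := domF k; first by rewrite -xE.
exists (a + comb s f).
  elim: F Ff {FX domF} => // f' F IHF [->|/IHF]; rewrite inE ?eqxx //.
  by move=> ->; rewrite orbT.
exists (fun i => k i - f i)%N; rewrite xE (combB lef); abel.
Qed.

(** Larger exponents give smaller monomials, so a maximum is to be found among
    the finitely many minimal exponents. *)
Lemma gset_max X : gset X -> (exists x, X x) ->
  exists2 m, X m & forall x, X x -> x = m \/ mlt x m.
Proof.
move=> gX [x0 Xx0]; have [s [t [ss tX domt]]] := gset_dickson gX.
have mt x : x \in t -> mmem x by move/tX; apply: gset_mem.
have [|m tm lem] := list_max mt.
  by have [y] := domt x0 Xx0; case: (t).
exists m; first exact: tX.
move=> x Xx; have [y ty [k xyE]] := domt x Xx.
have xE : x = y + comb s k by rewrite -xyE; abel.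
case: (comb_le0 k ss) => k0; first by rewrite xE k0 addr0; apply: lem.
have ltxy : mlt x y.
  by apply: sub_pos; move/neg_opp: k0; rewrite -xyE opprB.
right; case: (lem y ty) => [<-//|ltym].
by apply: mlt_trans ltxy ltym; [exact: gset_mem Xx| |]; auto.
Qed.

(** The minimal exponents given by Dickson's lemma yield the generators. *)
Lemma gset_small X : gset X -> (forall x, X x -> mlt x 0) ->
  exists2 u, mem_small u & forall x, X x -> monoid u x.
Proof.
move=> gX X0; have [s [t [ss tX domt]]] := gset_dickson gX.
exists (s ++ t).
  apply: mem_small_cat => // x /tX Xx; split; last exact: X0.
  exact: gset_mem Xx.
move=> x Xx; have [y ty sxy] := domt x Xx.
have -> : x = y + (x - y) by abel.
apply: monoidD; first by apply: monoid_mem; rewrite mem_cat ty orbT.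
by apply: monoid_sub sxy => z sz; apply: monoid_mem; rewrite mem_cat sz.
Qed.

(** In an infinite set in which nonempty subsets have maxima, let [g] be
    maximal with infinitely many elements above it: those strictly above [g]
    have no minimum. *)
Lemma finite_minmax (A : set M) :
  (forall B : set M, B `<=` A -> B !=set0 ->
     exists2 m, B m & forall x, B x -> x = m \/ mlt x m) ->
  (forall B : set M, B `<=` A -> B !=set0 ->
     exists2 m, B m & forall x, B x -> x = m \/ mlt m x) ->
  finite_set A.
Proof.
move=> maxA minA; apply: contrapT => infA.
pose up (g : M) : set M := [set x | A x /\ (x = g \/ mlt g x)].
pose B : set M := [set g | A g /\ ~ finite_set (up g)].
have A0 : A !=set0 by apply: contrapT => /nonemptyPn A0; apply: infA; rewrite A0.
have [m0 Am0 lem0] := minA A (@subset_refl _ _) A0.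
have upm0 : A `<=` up m0 by move=> x Ax; split; auto.
have Bm0 : B m0 by split=> // /(sub_finite_set upm0).
have [g [Ag infg] leg] := maxA B (fun x => @proj1 _ _) (ex_intro _ _ Bm0).
pose C : set M := [set x | A x /\ mlt g x].
have upC : up g `<=` [set g] `|` C by move=> x [Ax [->|gx]]; [left|right].
have infC : ~ finite_set C.
  move=> finC; apply: infg; apply: sub_finite_set upC _.
  by rewrite finite_setU; split=> //; apply: finite_set1.
have C0 : C !=set0 by apply: contrapT => /nonemptyPn C0; apply: infC; rewrite C0.
have [h [Ah gh] leh] := minA C (fun x => @proj1 _ _) C0.
have Cup : C `<=` up h by move=> x Cx; split; [exact: Cx.1|exact: leh].
have Bh : B h by split=> // /(sub_finite_set Cup).
case: (leg h Bh) => [hg|]; first by apply: (@mltxx g); rewrite -{2}hg.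
exact: mlt_asym gh.
Qed.

(** The map [x |-> h - x] reverses the order, so the subsets of the given set
    have maxima because [X] is a grid, and minima because [Y] is one. *)
Lemma gset_fin X Y h : gset X -> gset Y -> finite_set [set x | X x /\ Y (h - x)].
Proof.
move=> gX gY; apply: finite_minmax => B BA [x Bx].
  apply: gset_max; last by exists x.
  by apply: gset_sub gX => y /BA[].
have gY' : gset (fun y => B (h - y)).
  by apply: gset_sub gY => y /BA[_]; rewrite opprB addrC subrK.
have [|m Bm lem] := gset_max gY'; first by exists (h - x); rewrite opprB addrC subrK.
exists (h - m) => // y By; case: (lem (h - y)).
- by rewrite opprB addrC subrK.
- by move=> <-; left; abel.
- move/pos_sub => lt; right; apply: sub_pos.
  by have <- : m - (h - y) = y - (h - m) by abel.
Qed.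

(** * Grid-based series *)

Implicit Types (S T U : gseries M).

Definition gb T := gset (fun g => T g != 0).

Lemma grid_basedP T : grid_based T <-> gb T.
Proof.
split=> [[n [mu [m [smu gmu]]]]|[a [s [ma ss Ts]]]].
  exists (\sum_i mu i *~ m i), (codom mu); split.
  - by apply: mem_sum => i; apply: memMz; case: (smu i).
  - by move=> _ /codomP[i ->].
  move=> g /gmu[k [lemk ->]]; exists (\sum_i mu i *~ (k i - m i)).
    elim/big_ind: _ => [||i _]; [exact: monoid0|exact: monoidD|].
    have -> : k i - m i = Posz `|k i - m i| by rewrite gez0_abs // subr_ge0.
    elim: absz => [|p IHp]; first exact: monoid0.
    have -> : mu i *~ p.+1 = mu i + mu i *~ p by rewrite -!pmulrn mulrS.
    by apply: monoidD => //; apply/monoid_mem/codom_f.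
  by rewrite -big_split; apply: eq_bigr => i _ /=; rewrite -mulrzDr addrC subrK.
(* The corner [a] is a power of a small monomial [e], which becomes an
   additional generator with lower bound [m0] for its exponent. *)
have [e [m0 [me e0 aE]]] : exists e (m0 : int), [/\ mmem e, mlt e 0 & a = e *~ m0].
  case: (om_total OM ma) => [->|a0|a0].
  - have [e me pe] := om_nontrivial OM; exists (- e), 0; split=> //.
      exact: memN.
    by apply/neg_opp; rewrite opprK.
  - exists (- a), (-1); split; [exact: memN| |by rewrite mulrNz mulNrz opprK].
    by apply/neg_opp; rewrite opprK.
  - by exists a, 1; split=> //; apply/neg_opp.
exists (size s), (fun i => (e :: s)`_i), (fun i => if (i == 0 :> nat)%N then m0 else 0).
split=> [i|g /Ts[_ [k ->] ->]].
  have : (e :: s)`_i \in e :: s by rewrite mem_nth.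
  by rewrite inE => /orP[/eqP ->|/ss].
exists (fun i => if (i == 0 :> nat)%N then m0 else Posz (k i.-1)).
split=> [i|]; first by case: eqP.
by rewrite big_ord_recl /= aE.
Qed.

Lemma gb_mem T g : gb T -> T g != 0 -> mmem g. Proof. exact: gset_mem. Qed.

Lemma gb0 : gb (0 : gseries M).
Proof. by apply: gset_sub gset0 => g /eqP. Qed.

Lemma gbD S T : gb S -> gb T -> gb (S + T).
Proof.
move=> gS gT; apply: gset_sub (gsetU gS gT) => g.
have -> : (S + T) g = S g + T g by [].
by case: (eqVneq (S g) 0) => [->|]; auto; rewrite add0r; auto.
Qed.

Lemma gbZ (c : R) T : gb T -> gb (c *: T).
Proof.
move=> gT; apply: gset_sub gT => g.
have -> : (c *: T) g = c * T g by [].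
by rewrite mulf_eq0 negb_or => /andP[].
Qed.

Lemma gbN T : gb T -> gb (- T).
Proof. by rewrite -scaleN1r; apply: gbZ. Qed.

Lemma gbB S T : gb S -> gb T -> gb (S - T).
Proof. by move=> gS gT; apply/gbD/gbN. Qed.

Lemma mono_neq0 g h : (mono g : gseries M) h != 0 -> h = g.
Proof. by rewrite /mono; case: (h =P g) => //= _; rewrite eqxx. Qed.

Lemma monoE g : (mono g : gseries M) g = 1.
Proof. by rewrite /mono eqxx. Qed.

Lemma gb_mono g : mmem g -> gb (mono g).
Proof. by move=> mg; apply: gset_sub (gset1 mg) => h /mono_neq0. Qed.

Lemma mag_exists T : gb T -> (exists g, T g != 0) -> exists g, is_mag T g.
Proof.
move=> gT nzT; have [m Tm lem] := gset_max gT nzT.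
by exists m; split=> // h /lem[].
Qed.

Lemma smul_monor T g h : smul T (mono g) h = T (h - g).
Proof.
rewrite /smul (fsum_single (i0 := h - g)) => [|i ni]; last first.
  rewrite /mono; case: eqP => [hi|]; last by rewrite mulr0.
  by case/eqP: ni; rewrite -hi; abel.
have -> : h - (h - g) = g by abel.
by rewrite monoE mulr1.
Qed.

Lemma smul_monol T g h : smul (mono g) T h = T (h - g).
Proof.
rewrite /smul (fsum_single (i0 := g)) ?monoE ?mul1r // => i /eqP ni.
by rewrite /mono; case: eqP => // _; rewrite mul0r.
Qed.

End OrderedMonomials.

(** * Exponential extension *)

Section ExpExtension.
Variables (R : realType) (M : monomials R).
Hypothesis OM : ordered_monomials M.
Implicit Types (S T : gseries M) (g h : M).

Lemma mag_uniq T g h : is_mag T g -> is_mag T h -> g = h.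
Proof.
move=> [Tg leg] [Th leh]; apply: contrapT => ne; apply: (mlt_asym OM (leh g Tg ne)).
by apply: leg => // hg; apply: ne.
Qed.

Lemma mag_le T g h : is_mag T g -> T h != 0 -> h = g \/ mlt h g.
Proof. by move=> [_ leg] Th; case: (pselect (h = g)); auto. Qed.

Lemma magN T g : is_mag T g -> is_mag (- T) g.
Proof.
have TN h : (- T) h = - T h by [].
by move=> [Tg leg]; split=> [|h]; rewrite TN oppr_eq0 //; apply: leg.
Qed.

Lemma spos0F : ~ spos (0 : gseries M).
Proof. by move=> [g [[/eqP]]]. Qed.

Lemma spos_asym T : spos T -> ~ spos (- T).
Proof.
move=> [g [mg Tg]] [h [mh Th]]; have := mag_uniq (magN mg) mh => gh.
move: Th; rewrite -gh; have -> : (- T) g = - T g by [].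
by rewrite oppr_gt0 ltNge ltW.
Qed.

Lemma spos_dominant S T g : is_mag S g -> 0 < S g ->
  (forall h, T h != 0 -> mlt h g) -> spos (S + T).
Proof.
move=> [Sg leg] Spos Tlt; have STE h : (S + T) h = S h + T h by [].
have Tg : T g = 0.
  by apply/eqP/negPn/negP => /Tlt; apply: mltxx.
exists g; split; last by rewrite STE Tg addr0.
split=> [|h]; rewrite STE; first by rewrite Tg addr0.
by have [Sh|Sh _] := eqVneq (S h) 0; [rewrite Sh add0r => /Tlt|exact: leg].
Qed.

Lemma sposD S T : gb S -> gb T -> spos S -> spos T -> spos (S + T).
Proof.
move=> gS gT [g [mg Sg]] [h [mh Th]].
have mem_g := gb_mem OM gS mg.1; have mem_h := gb_mem OM gT mh.1.
case: (mlt_total OM mem_g mem_h) => [gh|gh|hg].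
- subst h; exists g; have STE k : (S + T) k = S k + T k by [].
  rewrite /is_mag STE; split; last exact: addr_gt0.
  split=> [|k]; first by rewrite gt_eqF // addr_gt0.
  rewrite STE; have [Sk|Sk _] := eqVneq (S k) 0; last exact: mg.2.
  by rewrite Sk add0r; apply: mh.2.
- rewrite addrC; apply: spos_dominant mh Th _ => k Sk.
  case: (mag_le mg Sk) => [->//|kg]; apply: mlt_trans kg gh => //.
  exact: gb_mem Sk.
- apply: spos_dominant mg Sg _ => k Tk.
  case: (mag_le mh Tk) => [->//|kh]; apply: mlt_trans kh hg => //.
  exact: gb_mem Tk.
Qed.

Lemma spos_total T : gb T -> [\/ T = 0, spos T | spos (- T)].
Proof.
move=> gT; have [nz|z] := pselect (exists g, T g != 0); last first.
  constructor 1; apply/funext => g; apply: contrapT => /eqP Tg; apply: z.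
  by exists g.
have [g mg] := mag_exists OM gT nz; have Tg := mg.1.
case: (ltrgt0P (T g)) Tg => // Tg _; [constructor 2|constructor 3]; exists g.
  by [].
by split; [exact: magN|have -> : (- T) g = - T g by []; rewrite oppr_gt0].
Qed.

Lemma exp_pos (g : exp_extension M) :
  mlt 0 g <-> spos g.2 \/ (g.2 = 0 /\ 0 < g.1).
Proof.
have -> : mlt 0 g = (spos (g.2 - 0) \/ (0 = g.2 /\ 0 < g.1)) by [].
by rewrite subr0; split=> [[|[]]|[|[]]]; auto.
Qed.

Lemma exp_mem (g : exp_extension M) : mmem g <-> gb g.2 /\ purely_large g.2.
Proof. by split=> [] [/(grid_basedP OM)]. Qed.

Lemma purely_largeD S T : purely_large S -> purely_large T -> purely_large (S + T).
Proof.
move=> lS lT g; have -> : (S + T) g = S g + T g by [].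
by have [->|/lS //] := eqVneq (S g) 0; rewrite add0r => /lT.
Qed.

Lemma purely_largeZ (c : R) T : purely_large T -> purely_large (c *: T).
Proof.
move=> lT g; have -> : (c *: T) g = c * T g by [].
by rewrite mulf_eq0 negb_or => /andP[_ /lT].
Qed.

Lemma exp_ordered : ordered_monomials (exp_extension M).
Proof.
split.
- move=> g h; rewrite exp_pos.
  have -> : mlt g h = (spos (h.2 - g.2) \/ (g.2 = h.2 /\ g.1 < h.1)) by [].
  have -> : (h - g).2 = h.2 - g.2 by []; have -> : (h - g).1 = h.1 - g.1 by [].
  rewrite subr_gt0; split=> [[|[->]]|[|[/eqP]]]; auto.
    by rewrite subrr; auto.
  by rewrite subr_eq0 => /eqP ->; auto.
- move=> g /exp_pos pg /exp_pos; have -> : (- g).2 = - g.2 by [].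
  have -> : (- g).1 = - g.1 by [].
  case: pg => [pg|[g0 pg]]; case=> [ng|[/eqP]].
  + exact: spos_asym pg ng.
  + by rewrite oppr_eq0 => /eqP g0; move: pg; rewrite g0 => /spos0F.
  + by move: ng; rewrite g0 oppr0 => /spos0F.
  + by rewrite oppr_gt0 ltNge ltW.
- by apply/exp_mem; split; [exact: gb0|move=> g /eqP].
- move=> g h /exp_mem[gg lg] /exp_mem[gh lh]; apply/exp_mem.
  have -> : (g - h).2 = g.2 - h.2 by [].
  split; first exact: gbB.
  by rewrite -scaleN1r; apply/purely_largeD/purely_largeZ.
- move=> g h /exp_mem[gg _] /exp_mem[gh _] /exp_pos pg /exp_pos ph; apply/exp_pos.
  have -> : (g + h).2 = g.2 + h.2 by []; have -> : (g + h).1 = g.1 + h.1 by [].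
  case: pg ph => [pg|[-> pg]] [ph|[-> ph]]; rewrite ?addr0 ?add0r; auto.
    by left; apply: sposD.
  by right; split=> //; apply: addr_gt0.
- move=> g /exp_mem[gg _].
  have p1 : mlt 0 (- g) <-> spos (- g.2) \/ (- g.2 = 0 /\ 0 < - g.1) by exact: exp_pos.
  case: (spos_total gg) => [g0|pg|ng].
  + case: (ltrgt0P g.1) => g1.
    * by constructor 2; apply/exp_pos; right.
    * by constructor 3; apply/p1; right; rewrite g0 oppr0 oppr_gt0.
    * by constructor 1; case: g g0 g1 {gg p1} => b L /= -> ->.
  + by constructor 2; apply/exp_pos; left.
  + by constructor 3; apply/p1; left.
- exists (1, 0); first by apply/exp_mem; split; [exact: gb0|move=> g /eqP].
  by apply/exp_pos; right; split=> //; exact: ltr01.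
Qed.

End ExpExtension.

Lemma G_ordered (R : realType) (N : nat) : ordered_monomials (G R N).
Proof.
elim: N => [|N IHN] /=; last exact: exp_ordered.
split=> //=.
- by move=> g h; rewrite subr_gt0.
- by move=> g g0; rewrite oppr_gt0 => /(lt_trans g0); rewrite ltxx.
- by move=> g h _ _; apply: addr_gt0.
- move=> g _; rewrite oppr_gt0; case: (ltrgt0P g) => g0.
  + by constructor 2.
  + by constructor 3.
  + by constructor 1.
- by exists 1.
Qed.

(** * Embeddings of monomial groups *)

Record monomial_emb (R : realType) (M M' : monomials R) (f : M -> M') : Prop := {
  me_mem : forall g, mmem g -> mmem (f g);
  me_B : forall g h, mmem g -> mmem h -> f (g - h) = f g - f h;
  me_pos : forall g, mmem g -> mlt 0 g -> mlt 0 (f g) }.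

(** The strongly linear extension of an embedding just moves the coefficients
    from [g] to [f g]. Inclusions of levels and composition with [exp] are of
    this form. *)
Definition fext (R : realType) (M M' : monomials R) (f : M -> M') :
  gseries M -> gseries M' := sext (fun g => mono (f g)).

Section Embeddings.
Variables (R : realType) (M M' : monomials R) (f : M -> M').
Hypotheses (OM : ordered_monomials M) (OM' : ordered_monomials M').
Hypothesis fM : monomial_emb f.
Implicit Types (S T : gseries M) (g h : M).

Lemma me_0 : f 0 = 0.
Proof. by rewrite -{1}(subrr 0) (me_B fM) ?subrr //; apply: om_mem0 OM. Qed.

Lemma me_N g : mmem g -> f (- g) = - f g.
Proof. by move=> mg; rewrite -sub0r (me_B fM) ?me_0 ?sub0r //; apply: om_mem0 OM. Qed.

Lemma me_D g h : mmem g -> mmem h -> f (g + h) = f g + f h.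
Proof.
move=> mg mh; rewrite -{1}[h]opprK (me_B fM) ?me_N ?opprK //; exact: memN.
Qed.

Lemma me_lt g h : mmem g -> mmem h -> mlt g h -> mlt (f g) (f h).
Proof.
move=> mg mh /(pos_sub OM) gh; apply: (sub_pos OM'); rewrite -(me_B fM) //.
by apply: (me_pos fM) => //; exact: (om_memB OM mh mg).
Qed.

Lemma me_inj g h : mmem g -> mmem h -> f g = f h -> g = h.
Proof.
move=> mg mh fgh; case: (mlt_total OM mg mh) => // gh.
  by have := me_lt mg mh gh; rewrite fgh => /(mltxx OM').
by have := me_lt mh mg gh; rewrite fgh => /(mltxx OM').
Qed.

Lemma fext_im T k : fext f T k != 0 -> exists2 g, T g != 0 & k = f g.
Proof.
move=> /fsum_neq0[g]; have -> : (T g *: mono (f g)) k = T g * mono (f g) k by [].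
by rewrite mulf_eq0 negb_or => /andP[Tg /mono_neq0]; exists g.
Qed.

Lemma fextE T g : gb T -> mmem g -> fext f T (f g) = T g.
Proof.
move=> gT mg; rewrite /fext /sext /ssum (fsum_single (i0 := g)).
  have -> : (T g *: mono (f g)) (f g) = T g * mono (f g) (f g) by [].
  by rewrite monoE mulr1.
move=> h nhg; have -> : (T h *: mono (f h)) (f g) = T h * mono (f h) (f g) by [].
apply/eqP; apply: contraNT nhg; rewrite mulf_eq0 negb_or => /andP[Th /mono_neq0 ghE].
by apply/eqP/esym/me_inj => //; apply: gb_mem Th.
Qed.

Lemma fextP T (T' : gseries M') : gb T ->
  (forall g, mmem g -> T' (f g) = T g) ->
  (forall k, T' k != 0 -> exists2 g, mmem g & k = f g) ->
  fext f T = T'.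
Proof.
move=> gT T'E T'im; apply/funext => k.
have [[g [mg ->]]|nk] := pselect (exists g, mmem g /\ k = f g).
  by rewrite fextE ?T'E.
have -> : T' k = 0.
  by apply/eqP/negPn/negP => /T'im[g mg kE]; apply: nk; exists g.
apply/eqP/negPn/negP => /fext_im[g Tg kE]; apply: nk; exists g.
by split=> //; apply: gb_mem Tg.
Qed.

Lemma fextD S T : gb S -> gb T -> fext f (S + T) = fext f S + fext f T.
Proof.
move=> gS gT; have sE k : (fext f S + fext f T) k = fext f S k + fext f T k by [].
apply: fextP => [|g mg|k]; first exact: gbD.
  by rewrite sE !fextE.
rewrite sE; have [->|/fext_im[g Sg ->] _] := eqVneq (fext f S k) 0.
  by rewrite add0r => /fext_im[g Tg ->]; exists g => //; apply: gb_mem Tg.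
by exists g => //; apply: gb_mem Sg.
Qed.

Lemma fextZ (c : R) T : gb T -> fext f (c *: T) = c *: fext f T.
Proof.
move=> gT; have sE k : (c *: fext f T) k = c * fext f T k by [].
apply: fextP => [|g mg|k]; first exact: gbZ.
  by rewrite sE fextE.
rewrite sE mulf_eq0 negb_or => /andP[_ /fext_im[g Tg ->]].
by exists g => //; apply: gb_mem Tg.
Qed.

Lemma fext0 : fext f 0 = 0.
Proof. by rewrite -(scale0r (0 : gseries M)) fextZ ?scale0r //; apply: gb0. Qed.

Lemma fextB S T : gb S -> gb T -> fext f (S - T) = fext f S - fext f T.
Proof.
move=> gS gT; rewrite -(scaleN1r T) -(scaleN1r (fext f T)).
by rewrite fextD ?fextZ //; apply: gbZ.
Qed.

Lemma gset_image (X : M -> Prop) : gset X ->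
  gset (fun k => exists2 g, X g & k = f g).
Proof.
move=> [a [s [ma ss Xs]]]; exists (f a), (map f s); split; first exact: (me_mem fM).
  move=> _ /mapP[x /ss[mx x0] ->]; split; first exact: (me_mem fM).
  by rewrite -me_0; apply: me_lt => //; apply: om_mem0 OM.
move=> _ [_ /Xs[_ [k ->] ->] ->]; exists (f (comb s k)); last first.
  by rewrite me_D //; apply: comb_mem.
have mk i : mmem (s`_(i : 'I_(size s)) *+ k i).
  exact/(memMn OM)/(ss _ _).1/mem_nth.
suff [] : mmem (comb s k) /\ monoid (map f s) (f (comb s k)) by [].
rewrite /comb; elim/big_ind: _ => [||i _].
- by rewrite me_0; split; [exact: om_mem0 OM|exact: monoid0].
- move=> x y [mx fx] [my fy]; split; first exact: memD.
  by rewrite me_D //; apply: monoidD.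
- split=> //; have mi : mmem s`_i by exact/(ss _ _).1/mem_nth.
  elim: (k i) => [|n IHn]; first by rewrite mulr0n me_0; exact: monoid0.
  rewrite mulrS me_D //; last exact: memMn.
  apply: monoidD => //; apply: monoid_mem; apply: map_f; exact: mem_nth.
Qed.

Lemma fext_gb T : gb T -> gb (fext f T).
Proof. by move=> gT; apply: gset_sub (gset_image gT) => k /fext_im. Qed.

Lemma fext_mono g : mmem g -> fext f (mono g) = mono (f g).
Proof.
move=> mg; apply: fextP => [|h mh|k /mono_neq0->]; [exact: gb_mono| |by exists g].
have [->|nhg] := eqVneq h g; first by rewrite !monoE.
rewrite /mono (negPf nhg); case: (f h =P f g) => // /(me_inj mh mg) hg.
by rewrite hg eqxx in nhg.
Qed.

Lemma fext_purely_large T : gb T -> purely_large T -> purely_large (fext f T).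
Proof.
move=> gT lT k /fext_im[g Tg ->]; apply: (me_pos fM); last exact: lT.
exact: gb_mem Tg.
Qed.

Lemma fext_mag T g : gb T -> is_mag T g -> is_mag (fext f T) (f g).
Proof.
move=> gT [Tg leg]; have mg := gb_mem OM gT Tg.
split=> [|_ /fext_im[h Th ->] nhg]; first by rewrite fextE.
have mh := gb_mem OM gT Th.
by apply: me_lt => //; apply: leg => // hg; rewrite hg in nhg.
Qed.

Lemma fext_spos T : gb T -> spos T -> spos (fext f T).
Proof.
move=> gT [g [mg Tg]]; exists (f g); split; first exact: fext_mag.
by rewrite fextE //; apply: gb_mem mg.1.
Qed.

Definition exp_emb (g : exp_extension M) : exp_extension M' := (g.1, fext f g.2).

Lemma exp_emb_emb : monomial_emb exp_emb.
Proof.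
split.
- move=> g /(exp_mem OM)[gg lg]; apply/(exp_mem OM').
  by split; [exact: fext_gb|exact: fext_purely_large].
- move=> g h /(exp_mem OM)[gg lg] /(exp_mem OM)[gh lh].
  by rewrite /exp_emb; congr pair; exact: fextB.
- move=> g /(exp_mem OM)[gg lg] /exp_pos pg; apply/exp_pos.
  case: pg => [pg|[g0 pg]]; [left; exact: fext_spos|right].
  by split=> //=; rewrite g0 fext0.
Qed.

End Embeddings.

Lemma embG_emb (R : realType) (N : nat) : monomial_emb (@embG R N).
Proof.
elim: N => [|N IHN]; last exact: exp_emb_emb (G_ordered R N) (G_ordered R N.+1) IHN.
split=> [g _|g h _ _|g _ pg] /=.
- apply: (proj2 (exp_mem (G_ordered R 0) (g, 0))).
  by split; [exact: gb0 (G_ordered R 0)|move=> h /eqP].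
- by congr pair; rewrite subr0.
- by apply: (proj2 (@exp_pos R (powers_of_x R) (g, 0))); right.
Qed.

(** * Triangular systems *)

Section Triangular.
Variables (R : realType) (M : monomials R).
Hypothesis OM : ordered_monomials M.
Variables (X : M -> Prop) (a : M -> M -> R) (w : M -> R).
Hypothesis gX : gset X.

Let above (h g : M) : Prop := [/\ X h, X g & mlt g h].

(** Nonempty subsets of a grid have a largest element. *)
Lemma above_wf : well_founded above.
Proof.
move=> g0; apply: contrapT => nacc0.
have Xacc g : ~ Acc above g -> X g.
  move=> nacc; apply: contrapT => nX; apply: nacc; constructor => h [_ Xg _].
  by case: nX.
have gN : gset (fun g => ~ Acc above g) by apply: gset_sub gX.
have [m nm lem] := gset_max OM gN (ex_intro (fun g => ~ Acc above g) g0 nacc0).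
apply: nm; constructor => h [_ _ mh]; apply: contrapT => nh.
case: (lem h nh) => [hm|]; last exact: mlt_asym mh.
by move: mh; rewrite hm => /(mltxx OM).
Qed.

(** The unknowns are determined from the largest monomial downwards. *)
Lemma triangular_solution :
  (forall g, X g -> a g g != 0) ->
  (forall g h, X g -> X h -> mlt h g -> a g h = 0) ->
  (forall g, X g -> finite_set [set h | X h /\ a g h != 0]) ->
  exists S : M -> R, (forall g, S g != 0 -> X g) /\
    forall g, X g -> \sum_(h \in [set: M]) ((S h * a g h : R) : R^o) = w g.
Proof.
move=> nza a0 fina.
pose tail g (rec : forall h, above h g -> R) : R^o :=
  \sum_(h \in [set: M])
    (if pselect (above h g) is left hg then rec h hg * a g h : R^o else 0).
pose F g rec := if pselect (X g) then (w g - tail g rec) / a g g else 0.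
pose S := Fix above_wf (fun _ => R : Type) F.
have SE g : S g = F g (fun h _ => S h).
  rewrite /S Fix_eq // => {}g r1 r2 r12; congr F.
  by apply/functional_extensionality_dep => h; apply/functional_extensionality_dep.
have SX g : S g != 0 -> X g.
  by rewrite SE /F; case: pselect => // nX; rewrite eqxx.
exists S; split=> // g Xg.
pose rest h : R^o := if pselect (above h g) is left _ then S h * a g h else 0.
pose diag h : R^o := if h == g then S h * a g h else 0.
transitivity (\sum_(h \in [set: M]) (diag h + rest h)).
  apply: eq_fsbigr => h _; rewrite /diag /rest; case: eqP => [->|nhg].
    case: pselect => [ab|nab]; last by rewrite addr0.
    by case: (ab) => _ _ /(mltxx OM).
  rewrite add0r; case: pselect => // nab.
  have [->|Sh] := eqVneq (S h) 0; first by rewrite mul0r.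
  have Xh := SX h Sh.
  case: (mlt_total OM (gset_mem OM gX Xh) (gset_mem OM gX Xg)) => //.
    by move=> hg; rewrite a0 ?mulr0.
  by move=> gh; case: nab.
rewrite fsumD; first last.
- apply: sub_finite_set (fina g Xg) => h /=; rewrite /rest.
  case: pselect => [ab|nab]; last by rewrite eqxx.
  case: (ab) => Xh _ _; by rewrite mulf_eq0 negb_or => /andP[].
- apply: sub_finite_set (finite_set1 g) => h /=; rewrite /diag.
  by case: (h =P g) => // _; rewrite eqxx.
rewrite (fsum_single (i0 := g)) => [|h]; last by rewrite /diag => /negPf ->.
rewrite /diag eqxx {1}SE /F; case: pselect => // Xg'.
by rewrite divfK ?nza // /tail subrK.
Qed.

End Triangular.

(** * Finite-dimensional spaces of series *)

Section Span.
Variables (R : realType) (M : monomials R).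
Hypothesis OM : ordered_monomials M.
Implicit Types (ps : seq (gseries M)) (u v p : gseries M) (m q : M).

Fixpoint span ps v : Prop :=
  if ps is p :: ps' then exists c : R, span ps' (v - c *: p) else v = 0.

Lemma span0 ps : span ps 0.
Proof. by elim: ps => //= p ps IHps; exists 0; rewrite scale0r subr0. Qed.

Lemma spanZD ps (c : R) u v : span ps u -> span ps v -> span ps (c *: u + v).
Proof.
elim: ps u v => [|p ps IHps] u v /=; first by move=> -> ->; rewrite scaler0 addr0.
move=> [b ub] [e ve]; exists (c * b + e); have := IHps _ _ ub ve; congr span.
by apply/funext => q; rewrite !serE; ring.
Qed.

Lemma spanB ps u v : span ps u -> span ps v -> span ps (u - v).
Proof. by move=> su sv; rewrite addrC -scaleN1r; apply: spanZD. Qed.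

Lemma span_in ps p : List.In p ps -> span ps p.
Proof.
elim: ps => //= p' ps IHps [->|/IHps sp].
  by exists 1; rewrite scale1r subrr; apply: span0.
by exists 0; rewrite scale0r subr0.
Qed.

Lemma span_supp ps v q : span ps v -> v q != 0 ->
  exists2 p, List.In p ps & p q != 0.
Proof.
elim: ps v => [|p ps IHps] v /=; first by move=> ->; rewrite eqxx.
move=> [c sv] vq; have [pq|pq] := eqVneq (p q) 0; last by exists p; auto.
have [|p' ps' p'q] := IHps _ sv; last by exists p'; auto.
have -> : (v - c *: p) q = v q - c * p q by [].
by rewrite pq mulr0 subr0.
Qed.

Lemma span_gb ps v : (forall p, List.In p ps -> gb p) -> span ps v -> gb v.
Proof.
elim: ps v => [|p ps IHps] v /= gps; first by move=> ->; apply: gb0.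
move=> [c sv]; rewrite -(subrK (c *: p) v).
apply: gbD => //; last by apply/gbZ/gps; left.
by apply: IHps sv => p' ps'; apply: gps; right.
Qed.

(** Adding a vector to a spanning family creates at most one new magnitude: if
    [v1] and [v2] had new magnitudes [m2 < m1], then the combination of [v1] and
    [v2] without component on the new vector would have magnitude [m1]. *)
Lemma span_mags ps : (forall p, List.In p ps -> gb p) ->
  exists E : seq M, forall v m, span ps v -> is_mag v m -> m \in E.
Proof.
elim: ps => [|p ps IHps] gps; first by exists [::] => _ m /= -> [/eqP].
have [|E mE] := IHps; first by move=> p' ps'; apply: gps; right.
have new v1 v2 m1 m2 : span (p :: ps) v1 -> span (p :: ps) v2 ->
    is_mag v1 m1 -> is_mag v2 m2 -> m2 \notin E -> mlt m2 m1 -> m1 \in E.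
  move=> s1 s2 mag1 mag2 nE2 lt21.
  have [[c1 s1'] [c2 s2']] := (s1, s2).
  have c2_neq0 : c2 != 0.
    apply: contraNneq nE2 => c20; apply: (mE v2) mag2.
    by move: s2'; rewrite c20 scale0r subr0.
  have mem1 := gb_mem OM (span_gb gps s1) mag1.1.
  have mem2 := gb_mem OM (span_gb gps s2) mag2.1.
  apply: (mE (v1 - (c1 / c2) *: v2)).
    have := spanZD (- (c1 / c2)) s2' s1'; congr span.
    by apply/funext => q; rewrite !serE; field.
  have uE q : (v1 - (c1 / c2) *: v2) q = v1 q - c1 / c2 * v2 q by [].
  split=> [|h]; rewrite uE.
    have [->|v2m1] := eqVneq (v2 m1) 0; first by rewrite mulr0 subr0; apply: mag1.1.
    case: (mag_le mag2 v2m1) => [m12|/(mlt_asym OM lt21) //].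
    by move: lt21; rewrite m12 => /(mltxx OM).
  have [v1h|v1h _] := eqVneq (v1 h) 0; last exact: mag1.2.
  have [->|v2h _ _] := eqVneq (v2 h) 0; first by rewrite v1h mulr0 subr0 eqxx.
  case: (mag_le mag2 v2h) => [->//|hm2]; apply: mlt_trans hm2 lt21 => //.
  exact: gb_mem (span_gb gps s2) v2h.
have [[v1 [m1 [s1 mag1 nE1]]]|none] := pselect (exists v m,
    [/\ span (p :: ps) v, is_mag v m & m \notin E]); last first.
  by exists E => v m sv mv; apply: contrapT => /negP nE; apply: none; exists v, m.
exists (m1 :: E) => v2 m2 s2 mag2; rewrite inE orbC.
case: (boolP (m2 \in E)) => //= nE2; apply/eqP.
have mem1 := gb_mem OM (span_gb gps s1) mag1.1.
have mem2 := gb_mem OM (span_gb gps s2) mag2.1.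
case: (mlt_total OM mem2 mem1) => // lt12.
  by move: nE1; rewrite (new _ _ _ _ s1 s2 mag1 mag2).
by move: nE2; rewrite (new _ _ _ _ s2 s1 mag2 mag1).
Qed.

Lemma gset_seq_supp ps : (forall p, List.In p ps -> gb p) ->
  gset (fun q => exists2 p, List.In p ps & p q != 0).
Proof.
elim: ps => [|p ps IHps] gps; first by apply: gset_sub (gset0 OM) => q [].
have gps' : gset (fun q => exists2 p, List.In p ps & p q != 0).
  by apply: IHps => p' ps'; apply: gps; right.
apply: gset_sub (gsetU OM (gps p (or_introl erefl)) gps') => q /=.
by move=> [p' [->|ps'] p'q]; [left|right; exists p'].
Qed.

End Span.

(** * Integration with respect to a logarithmic derivation *)

Section LogDerivation.
Variables (R : realType) (M : monomials R) (x : M) (d : M -> gseries M).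
Hypotheses (OM : ordered_monomials M) (mem_x : mmem x).
Implicit Types (S T W : gseries M) (g h q m : M).

(** If [d g] is the derivative of the monomial [g], then [psi g] is its
    logarithmic derivative [x g' / g] with respect to [x d/dx]. *)
Definition psi g : gseries M := fun q => d g (q + g - x).

Lemma deriv_psi g h : d g h = psi g (h - g + x).
Proof. by rewrite /psi; congr (d g _); abel. Qed.

Definition subgroup (Gam : M -> Prop) := [/\ forall g, Gam g -> mmem g, Gam 0 &
  forall g h, Gam g -> Gam h -> Gam (g - h)].

(** In [ld_span], the monomials of a grid lie in a group [Gam] whose elements
    have logarithmic derivatives in a finite-dimensional space of series with
    support in [Gam]: this bounds the supports of all derivatives and
    antiderivatives by grids. In [ld_pos], logarithmic derivatives of large
    monomials grow more slowly than these monomials. *)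
Record log_derivation : Prop := {
  ld_B : forall g h, mmem g -> mmem h -> psi (g - h) = psi g - psi h;
  ld_span : forall X, gset X -> exists (Gam : M -> Prop) ps,
    [/\ subgroup Gam, forall g, X g -> Gam g,
        forall p, List.In p ps -> gb p /\ forall q, p q != 0 -> Gam q &
        forall g, Gam g -> span ps (psi g)];
  ld_pos : forall g q, mmem g -> mlt 0 g -> psi g q != 0 ->
    (q = 0 \/ mlt 0 q) /\ mlt q g;
  ld_neq0 : forall g, mmem g -> g != 0 -> exists q, psi g q != 0 }.

Hypothesis LD : log_derivation.

Lemma psi0 : psi 0 = 0.
Proof. by rewrite -{1}(subrr 0) (ld_B LD) ?subrr //; apply: om_mem0 OM. Qed.

Lemma psiN g : mmem g -> psi (- g) = - psi g.
Proof.
by move=> mg; rewrite -sub0r (ld_B LD) ?psi0 ?sub0r //; apply: om_mem0 OM.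
Qed.

Lemma psi_gb g : mmem g -> gb (psi g).
Proof.
move=> mg; have [Gam [ps [_ XGam gps]]] := ld_span LD (gset1 mg).
by move=> /(_ g (XGam g erefl)); apply: span_gb => // p /gps[].
Qed.

Lemma psi_mem g q : mmem g -> psi g q != 0 -> mmem q.
Proof. by move=> mg; apply: gb_mem (psi_gb mg). Qed.

Lemma psi_mag g : mmem g -> g != 0 -> exists m, is_mag (psi g) m.
Proof. by move=> mg g0; apply: mag_exists (psi_gb mg) _ => //; apply: ld_neq0. Qed.

Lemma psi_ge0 g q : mmem g -> psi g q != 0 -> q = 0 \/ mlt 0 q.
Proof.
move=> mg; have [->|g0|g0] := om_total OM mg.
- by rewrite psi0 => /eqP.
- by case/(ld_pos LD mg g0).
- have mN := memN OM mg; have gE : psi g q = - psi (- g) q.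
    by rewrite psiN // serN opprK.
  by rewrite gE oppr_eq0; case/(ld_pos LD mN g0).
Qed.

(** No term of the derivative of a monomial other than 1 is constant: up to
    the factor [x], these terms remain on the same side of 1. *)
Lemma psi_addr_neq0 g q : mmem g -> g != 0 -> psi g q != 0 -> g + q != 0.
Proof.
move=> mg /eqP g_neq0 qg; have mq := psi_mem mg qg.
have [//|g0|g0] := om_total OM mg.
  have [q0 _] := ld_pos LD mg g0 qg; apply: (pos_neq0 OM).
  by case: q0 => [->|q0]; rewrite ?addr0 //; apply: (om_posD OM).
have mN := memN OM mg; have gE : psi g q = - psi (- g) q.
  by rewrite psiN // serN opprK.
move: qg; rewrite gE oppr_eq0 => /(ld_pos LD mN g0)[_ /(pos_sub OM) qlt].
by rewrite -oppr_eq0 opprD; apply: (pos_neq0 OM).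
Qed.

(** The magnitudes of the derivatives are ordered like the monomials. As
    [psi h = psi g + psi p] for the small ratio [p] of [h] and [g], a term [q]
    of [psi h] is bounded by [m] or is less than the inverse of [p]. *)
Lemma psi_dominant g h m q : mmem g -> mmem h -> is_mag (psi g) m -> mlt h g ->
  psi h q != 0 -> mlt (h + q) (g + m).
Proof.
move=> mg mh magm hg qh; have mm := psi_mem mg magm.1; have mq := psi_mem mh qh.
have mp := om_memB OM mg mh; have p0 := pos_sub OM hg.
have m0 := psi_ge0 mg magm.1.
have hE : psi h = psi g - psi (g - h) by rewrite (ld_B LD) // opprB addrC subrK.
have [gq|gq] := eqVneq (psi g q) 0.
  have pq : psi (g - h) q != 0.
    by move: qh; rewrite hE !serE gq add0r oppr_eq0.
  have [_ /(pos_sub OM) qp] := ld_pos LD mp p0 pq.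
  apply: (sub_pos OM); have -> : g + m - (h + q) = (g - h - q) + m by abel.
  case: m0 => [->|m0]; first by rewrite addr0.
  by apply: (om_posD OM) => //; apply: (om_memB OM).
apply: (sub_pos OM); have -> : g + m - (h + q) = (g - h) + (m - q) by abel.
case: (mag_le magm gq) => [->|/(pos_sub OM) qm]; first by rewrite subrr addr0.
by apply: (om_posD OM) => //; apply: (om_memB OM).
Qed.

(** Derivatives are sums over a grid of translates of finitely many series, so
    each coefficient is a finite sum. *)
Lemma deriv_fin T h : gb T -> finite_set [set g | T g * d g h != 0].
Proof.
move=> gT; have [Gam [ps [_ XGam gps sps]]] := ld_span LD gT.
have gP := gset_seq_supp OM (fun p ps' => (gps p ps').1).
apply: sub_finite_set (gset_fin OM (h + x) gT gP) => g /=.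
rewrite mulf_eq0 negb_or deriv_psi => /andP[Tg].
have -> : h - g + x = h + x - g by abel.
by move=> pg; split=> //; apply: span_supp (sps g (XGam g Tg)) pg.
Qed.

Lemma sextE T h : sext d T h = \sum_(g \in [set: M]) ((T g * d g h : R) : R^o).
Proof. by []. Qed.

Lemma sext_neq0 T h : sext d T h != 0 -> exists2 g, T g != 0 & d g h != 0.
Proof.
rewrite sextE => /fsum_neq0[g]; rewrite mulf_eq0 negb_or => /andP[Tg dg].
by exists g.
Qed.

Lemma sextD S T : gb S -> gb T -> sext d (S + T) = sext d S + sext d T.
Proof.
move=> gS gT; apply/funext => h; rewrite serD !sextE -fsumD; try exact: deriv_fin.
by apply: eq_fsbigr => g _; rewrite serD mulrDl.
Qed.

Lemma sextB S T : gb S -> gb T -> sext d (S - T) = sext d S - sext d T.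
Proof.
move=> gS gT; have := sextD (gbB OM gS gT) gT; rewrite subrK => ->.
by rewrite addrK.
Qed.

Lemma sext_gb T : gb T -> gb (sext d T).
Proof.
move=> gT; have [Gam [ps [_ XGam gps sps]]] := ld_span LD gT.
have gP := gset_seq_supp OM (fun p ps' => (gps p ps').1).
apply: gset_sub (gsetD OM gT (gset_shift OM gP (memN OM mem_x))) => h /sext_neq0[g Tg].
rewrite deriv_psi => dg; exists g, (h - g); split=> //; last by abel.
by rewrite opprK; apply: span_supp (sps g (XGam g Tg)) dg.
Qed.

(** The magnitude of [T] dominates: no other term of [T] contributes to the
    coefficient at the leading monomial of its derivative. *)
Lemma sext_mag T g m : gb T -> is_mag T g -> is_mag (psi g) m ->
  sext d T (g + m - x) != 0.
Proof.
move=> gT magg magm; have mg := gb_mem OM gT magg.1; rewrite sextE.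
have dgE h : d h (g + m - x) = psi h (g + m - h) by rewrite deriv_psi; congr psi; abel.
rewrite (fsum_single (i0 := g)) /= ?dgE.
  have -> : g + m - g = m by abel.
  by rewrite mulf_neq0 //; [apply: magg.1|apply: magm.1].
move=> h nhg; apply/eqP; rewrite mulf_eq0; apply/orP.
have [Th|Th] := eqVneq (T h) 0; [by left|right; apply/negPn/negP].
rewrite dgE => dh; have [hg|hg] := mag_le magg Th; first by rewrite hg eqxx in nhg.
have := psi_dominant mg (gb_mem OM gT Th) magm hg dh.
have -> : h + (g + m - h) = g + m by abel.
exact: (mltxx OM).
Qed.

(** Let [m g] be the magnitude of [psi g], so that [g + m g] is the magnitude
    of [x g'].  The integral is sought on the set [B] of the [g] for which this
    magnitude lies in a set [J] that contains the support of [x W] and that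
    multiplication by the small ratios [q - m g], with [q] in the support of
    [psi g], maps to itself. Comparing the coefficients at [g + m g], for [g]
    in [B], gives a triangular system. *)
Theorem integral_exists W : gb W -> W (- x) = 0 -> exists2 S, gb S & sext d S = W.
Proof.
move=> gW W0.
have gX : gset (fun h => W (h - x) != 0) by apply: (gset_shift OM gW).
have [Gam [ps [[memG G0 GB] XG gps sps]]] := ld_span LD gX.
have GN g : Gam g -> Gam (- g) by rewrite -sub0r; apply: GB.
have GD g h : Gam g -> Gam h -> Gam (g + h).
  by move=> Gg /GN Gh; rewrite -[h]opprK; apply: GB.
pose P q := exists2 p, List.In p ps & p q != 0.
have gP : gset P by apply: (gset_seq_supp OM) => p /gps[].
have PG q : P q -> Gam q by move=> [p /gps[_ Gp] /Gp].
have psiP g q : Gam g -> psi g q != 0 -> P q.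
  by move=> Gg; apply: span_supp (sps g Gg).
have [E magE] := span_mags OM (fun p ps' => (gps p ps').1).
have [m magm] : exists m : M -> M, forall g, Gam g -> g != 0 -> is_mag (psi g) (m g).
  suff /choice[m mP] : forall g, exists m, Gam g -> g != 0 -> is_mag (psi g) m.
    by exists m.
  move=> g; have [[Gg g0]|nG] := pselect (Gam g /\ g != 0); last first.
    by exists 0 => Gg g0; case: nG.
  by have [m mP] := psi_mag (memG g Gg) g0; exists m.
have mP g : Gam g -> g != 0 -> P (m g).
  by move=> Gg g0; exact: (psiP g _ Gg (magm g Gg g0).1).
have mE g : Gam g -> g != 0 -> m g \in E.
  by move=> Gg g0; exact: (magE _ _ (sps g Gg) (magm g Gg g0)).
have gNE : gset (fun e => - e \in E /\ P (- e)).
  pose NE := [seq - e | e <- E & `[< P e >]].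
  apply: (gset_sub _ (gset_seq OM (s := NE) _)) => [e [Ee Pe]|_ /mapP[e + ->]].
    apply/mapP; exists (- e); last by rewrite opprK.
    by rewrite mem_filter Ee andbT; apply/asboolP.
  rewrite mem_filter => /andP[/asboolP Pe _].
  by apply: (memN OM); apply: memG; apply: PG.
pose Q r := exists q e, [/\ P q, e \in E /\ P e, r = q - e & mlt q e].
have gQ : gset Q.
  apply: gset_sub (gsetD OM gP gNE) => r [q [e [Pq [Ee Pe] -> _]]].
  by exists q, (- e); rewrite opprK.
have [|u su Qu] := gset_small OM gQ.
  by move=> _ [q [e [_ _ -> qe]]]; apply/(neg_opp OM); rewrite opprB; apply: pos_sub.
have [a [s [ma ss Xs]]] := gX.
(* [J] lies in the grid of [W] enlarged by the generators [u] of the small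
   ratios; 1 is excluded since no [x g'] contains it. *)
pose J h := [/\ Gam h, h != 0 & exists2 t, monoid (s ++ u) t & h = a + t].
have gJ : gset J by exists a, (s ++ u); split=> //; [exact: mem_small_cat|move=> h []].
pose B g := [/\ Gam g, g != 0 & J (g + m g)].
have gB : gset B.
  apply: gset_sub (gsetD OM gJ gNE) => g [Gg g0 Jg]; exists (g + m g), (- m g).
  by split=> //; rewrite ?opprK; [split; [exact: mE|exact: mP]|abel].
have BJ g q : B g -> psi g q != 0 -> J (g + q).
  move=> [Gg g0 [_ _ [t st gE]]] gq; have mg := memG g Gg.
  split; [by apply: GD => //; apply/PG/(psiP g)|exact: psi_addr_neq0|].
  case: (mag_le (magm g Gg g0) gq) => [->|qm]; first by exists t.
  exists (t + (q - m g)).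
    apply: (monoidD st); apply: (@monoid_sub _ _ u) => [y uy|].
      by apply: monoid_mem; rewrite mem_cat uy orbT.
    apply: Qu; exists q, (m g); split=> //; first exact: psiP gq.
    by split; [exact: mE|exact: mP].
  have -> : g + q = (g + m g) + (q - m g) by abel.
  by rewrite gE; abel.
(* The magnitude of [x g'] is [h] for [g] the ratio of [h] and [m h], since the
   terms of [psi (m h)] are less than [m h]. *)
have JB h : J h -> exists2 g, B g & h = g + m g.
  move=> Jh; have [Gh h0 _] := Jh; have mh := memG h Gh.
  have Gm := PG _ (mP h Gh h0); have mm := memG _ Gm.
  have Gg := GB _ _ Gh Gm; set g := h - m h in Gg.
  have psigE q : psi g q = psi h q - psi (m h) q by rewrite (ld_B LD) // !serE.
  have magh := magm h Gh h0.
  have psi_m q : psi (m h) q != 0 -> mlt q (m h).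
    case: (psi_ge0 mh magh.1) => [m0|m0]; first by rewrite m0 psi0 => /eqP.
    by case/(ld_pos LD mm m0).
  have magg : is_mag (psi g) (m h).
    split=> [|q]; rewrite psigE.
      rewrite (_ : psi (m h) (m h) = 0) ?subr0; first exact: magh.1.
      by apply/eqP/negPn/negP => /psi_m /(mltxx OM).
    have [->|/magh.2 lt _ //] := eqVneq (psi h q) 0.
    by rewrite sub0r oppr_eq0 => /psi_m.
  have g0 : g != 0 by apply: contraPneq magg.1 => ->; rewrite psi0 eqxx.
  have mgE : m g = m h by apply: mag_uniq (magm g Gg g0) magg.
  have hE : h = g + m g by rewrite mgE subrK.
  by exists g => //; split=> //; rewrite -hE.
pose A g h := psi h (g + m g - h).
have [|||S [SB SW]] := @triangular_solution R M OM B A (fun g => W (g + m g - x)) gB.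
- move=> g [Gg g0 _]; rewrite /A; have -> : g + m g - g = m g by abel.
  exact: (magm g Gg g0).1.
- move=> g h [Gg g0 _] [Gh _ _] hg; apply/eqP/negPn/negP => Agh.
  have := psi_dominant (memG g Gg) (memG h Gh) (magm g Gg g0) hg Agh.
  have -> : h + (g + m g - h) = g + m g by abel.
  exact: (mltxx OM).
- move=> g _; apply: sub_finite_set (gset_fin OM (g + m g) gB gP) => h [Bh Ah].
  by split=> //; case: Bh => Gh _ _; apply: psiP Ah.
have gS : gb (S : gseries M) by apply: gset_sub gB.
exists S => //; apply/funext => k.
have kE : k = (k + x) - x by abel.
have [Jk|nJk] := pselect (J (k + x)).
  have [g Bg gE] := JB _ Jk; rewrite {2}kE gE -(SW g Bg) sextE.
  apply: eq_fsbigr => h _; rewrite deriv_psi /A -gE; congr (_ * psi h _ : R); abel.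
have -> : W k = 0.
  apply/eqP/negPn/negP => Wk; have Xk : W (k + x - x) != 0 by rewrite -kE.
  apply: nJk; split; [exact: XG| |].
    by apply: contraNneq Wk => kx; rewrite kE kx sub0r W0.
  have [t st ->] := Xs _ Xk; exists t => //; apply: monoid_sub st => y sy.
  by apply: monoid_mem; rewrite mem_cat sy.
apply/eqP/negPn/negP => /sext_neq0[g Sg]; rewrite deriv_psi => dg; apply: nJk.
by have := BJ g _ (SB g Sg) dg; have -> : g + (k - g + x) = k + x by abel.
Qed.

End LogDerivation.

(** * The derivation of log-free transseries *)

Section ListIn.
Implicit Types (T U : Type).

Lemma In_cat T (s t : seq T) y : List.In y (s ++ t) <-> List.In y s \/ List.In y t.
Proof. exact: List.in_app_iff. Qed.

Lemma In_map T U (f : T -> U) (s : seq T) z :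
  List.In z (map f s) <-> exists2 y, List.In y s & z = f y.
Proof.
elim: s => [|y s IHs] /=; first by split=> // -[].
split=> [[<-|/IHs[w sw ->]]|[w [<-|sw] zE]]; first by exists y; auto.
- by exists w; auto.
- by left.
- by right; apply/IHs; exists w.
Qed.

Lemma In_mem (T : eqType) (s : seq T) y : List.In y s <-> y \in s.
Proof.
elim: s => //= z s IHs; rewrite inE.
by split=> [[->|/IHs ->]|/orP[/eqP->|/IHs]]; rewrite ?eqxx ?orbT; auto.
Qed.

End ListIn.

Section SpanMap.
Variables (R : realType) (M M' : monomials R) (f : M -> M').
Hypotheses (OM : ordered_monomials M) (OM' : ordered_monomials M').
Hypothesis fM : monomial_emb f.

Lemma span_cat (ps qs : seq (gseries M)) v : span qs v -> span (ps ++ qs) v.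
Proof.
by move=> sv; elim: ps => //= p ps IHps; exists 0; rewrite scale0r subr0.
Qed.

Lemma span_fext (ps : seq (gseries M)) v : (forall p, List.In p ps -> gb p) ->
  span ps v -> span (map (fext f) ps) (fext f v).
Proof.
elim: ps v => [|p ps IHps] v /= gps; first by move=> ->; exact: fext0.
have gp : gb p by apply: gps; left.
have gps' p' : List.In p' ps -> gb p' by move=> ps'; apply: gps; right.
move=> [c sv]; exists c; rewrite -fextZ // -fextB //; first exact: IHps.
  by rewrite -(subrK (c *: p) v); apply: gbD (span_gb OM gps' sv) (gbZ _ gp).
exact: gbZ.
Qed.

End SpanMap.

(** The impredicative form turns membership into an induction principle. *)
Definition generated (R : realType) (M : monomials R) (X : M -> Prop) (g : M) :=
  forall H : M -> Prop, H 0 -> (forall h k, H h -> H k -> H (h - k)) ->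
    (forall h, X h -> H h) -> H g.

Section Generated.
Variables (R : realType) (M : monomials R).
Hypothesis OM : ordered_monomials M.
Implicit Types (X : M -> Prop).

Lemma generated_in X g : X g -> generated X g.
Proof. by move=> Xg H _ _; apply. Qed.

Lemma generated0 X : generated X 0.
Proof. by move=> H. Qed.

Lemma generatedB X g h : generated X g -> generated X h -> generated X (g - h).
Proof. by move=> Gg Gh H H0 HB XH; exact: (HB _ _ (Gg H H0 HB XH) (Gh H H0 HB XH)). Qed.

Lemma generatedD X g h : generated X g -> generated X h -> generated X (g + h).
Proof.
move=> Gg Gh; rewrite -[h]opprK; apply: generatedB => //.
by rewrite -sub0r; apply: generatedB => //; apply: generated0.
Qed.

Lemma generated_monoid X (s : seq M) t : (forall y, y \in s -> X y) ->
  monoid s t -> generated X t.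
Proof.
move=> sX [k ->]; rewrite /comb; elim/big_ind: _ => [||i _].
- exact: generated0.
- exact: generatedD.
elim: (k i) => [|n IHn]; first by rewrite mulr0n; exact: generated0.
rewrite mulrS; apply: generatedD => //; apply: generated_in.
by apply: sX; apply: mem_nth.
Qed.

Lemma generated_subgroup X : (forall g, X g -> mmem g) -> subgroup (generated X).
Proof.
move=> mX; split=> [g Gg||g h]; [|exact: generated0|exact: generatedB].
by apply: Gg => // [|h k]; [exact: om_mem0 OM|exact: (om_memB OM)].
Qed.

End Generated.

Section Levels.
Variable R : realType.
Implicit Types (N : nat).

Lemma embE N (T : gseries (G R N)) : emb T = fext (@embG R N) T.
Proof. by []. Qed.

Lemma G_mem N (g : G R N.+1) : mmem g <-> gb g.2 /\ purely_large g.2.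
Proof. exact: exp_mem (G_ordered R N) g. Qed.

Lemma G_pos N (g : G R N.+1) : mlt 0 g <-> spos g.2 \/ (g.2 = 0 /\ 0 < g.1).
Proof. exact: exp_pos. Qed.

Lemma xpow_mem N b : mmem (xpow N b : G R N).
Proof.
case: N => [|N] //=.
by apply/(G_mem (b, 0)); split; [exact: gb0 (G_ordered R N)|move=> h /eqP].
Qed.

Lemma embG_xpow N b : embG (xpow N b : G R N) = xpow N.+1 b.
Proof.
case: N => [|N] //=; congr pair.
exact: (fext0 (G_ordered R N) (G_ordered R N.+1) (embG_emb R N)).
Qed.

Lemma xpowN N b : xpow N (- b) = - xpow N b :> G R N.
Proof.
by case: N => [|N] //=; rewrite -[RHS]/(- b, - 0) oppr0.
Qed.

(** The logarithm of a large monomial is less than any power of it: its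
    magnitude [k] is large, so the induction hypothesis bounds the magnitude
    of [log k] by [k]. *)
Lemma log_small N (g : G R N.+1) (k : G R N) n :
  mmem g -> mlt 0 g -> g.2 k != 0 -> mlt (embG (k *+ n)) g.
Proof.
elim: N g k n => [|N IHN] g k n; move=> /G_mem[gg lg] /G_pos pg gk.
  case: pg => [pg|[g0 _]]; last by move: gk; rewrite g0 => /eqP.
  by left => /=; rewrite subr0.
case: pg => [[m [magm pm]]|[g0 _]]; last by move: gk; rewrite g0 => /eqP.
have ON := G_ordered R N; have ON1 := G_ordered R N.+1.
have mk : mmem k := gb_mem ON1 gg gk.
have [gk2 lk2] := proj1 (G_mem k) mk.
have kn2 : (k *+ n).2 = n%:R *: k.2.
  elim: n => [|n IHn]; first by rewrite scale0r.
  by rewrite mulrS -[LHS]/(k.2 + (k *+ n).2) IHn mulrS scalerDl scale1r.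
suff : spos (g.2 - emb (k *+ n).2) by left.
rewrite kn2; apply: (spos_dominant ON1 magm pm) => h.
rewrite serN oppr_eq0 => /fext_im[q + ->]; rewrite serZ mulf_eq0 negb_or => /andP[_ kq].
have mq : mmem q := gb_mem ON gk2 kq.
have := IHN k q 1%N mk (lg k gk) kq; rewrite mulr1n => qk.
case: (mag_le magm gk) => [<-//|km]; apply: (mlt_trans ON1 _ mk _ qk km).
  exact: (me_mem (embG_emb R N) mq).
exact: gb_mem magm.1.
Qed.

Notation x N := (xpow N 1 : G R N).
Notation D N := (@derivG R N).
Notation psiG N := (psi (x N) (D N)).

Lemma psi_G0 b q : psiG 0 b q = b * (q == 0)%:R.
Proof.
rewrite -[LHS]/((b : R) * (q + b - 1 == b - 1)%:R); congr (_ * _%:R).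
have -> : q + b - 1 = (b - 1) + q by abel.
by rewrite -subr_eq0 addrAC subrr add0r.
Qed.

(** For [g = x^b e^L] this is [psi g = b + x L']. *)
Lemma psi_GS N (g : G R N.+1) q :
  psiG N.+1 g q = g.1 * (q == 0)%:R + emb (sext (D N) g.2) (q - x N.+1).
Proof.
have -> : psiG N.+1 g q = smul (g.1 *: mono (xpow N.+1 (-1)) +
    emb (sext (D N) g.2) : gseries (G R N.+1)) (mono g) (q + g - x N.+1) by [].
rewrite smul_monor; have -> : q + g - x N.+1 - g = q - x N.+1 by abel.
rewrite serD serZ /mono xpowN; congr (_ * _%:R + _).
by rewrite -subr_eq0; have -> : q - x N.+1 - - x N.+1 = q by abel.
Qed.

(** The second property, that differentiation commutes with the inclusion of
    levels, is needed along the induction: the subgroup found at level [N] has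
    to remain stable under logarithmic derivatives in level [N.+1]. *)
Definition deriv_level N := log_derivation (x N) (D N) /\
  forall g : G R N, mmem g -> psiG N.+1 (embG g) = fext (@embG R N) (psiG N g).

Lemma sext_emb N (T : gseries (G R N)) : deriv_level N -> gb T ->
  sext (D N.+1) (emb T) = emb (sext (D N) T).
Proof.
move=> [LD psiE] gT; have ON := G_ordered R N; have ON1 := G_ordered R N.+1.
have fM := embG_emb R N.
have dfE g h : mmem g -> D N.+1 (embG g) h =
    fext (@embG R N) (psiG N g) (h - embG g + x N.+1).
  by move=> mg; rewrite (deriv_psi (x N.+1) (D N.+1)) psiE.
have mx : mmem (x N) := xpow_mem N 1.
apply/esym/(fextP ON ON1 fM) => [|p mp|k].
- exact: (sext_gb ON mx LD).
- rewrite !sextE; apply: (fsum_image (P := fun h => T h != 0) (f := @embG R N)).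
  + move=> h h' Th Th'; apply: (me_inj ON ON1 fM); exact: (gb_mem ON gT).
  + move=> k; rewrite mulf_eq0 negb_or => /andP[/fext_im[h Th ->] _].
    by exists h.
  + move=> h Th; have mh := gb_mem ON gT Th.
    have mph : mmem (p - h) := om_memB ON mp mh.
    rewrite embE (fextE ON ON1 fM gT mh) dfE // -embG_xpow -(me_B fM) //.
    rewrite -(me_D ON fM) // (fextE ON ON1 fM (psi_gb ON LD mh)).
      by rewrite (deriv_psi (x N) (D N) h p).
    exact: memD.
  + by move=> h /negP/negPn/eqP ->; rewrite mul0r.
- move=> /sext_neq0[_ /fext_im[h Th ->]]; have mh := gb_mem ON gT Th.
  rewrite dfE // => /fext_im[q hq kE]; have mq := psi_mem ON LD mh hq.
  exists (q + h - x N); first by apply: (om_memB ON) => //; apply: memD.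
  rewrite (me_B fM) ?(me_D ON fM) ?embG_xpow -?kE //; last exact: memD.
  by abel.
Qed.

(** The induction step for the derivation: a finite set of monomials
    [x^b e^L] has derivatives involving finitely many series [L'] of the lower
    level, and the induction hypothesis for these provides the subgroup. *)
Lemma log_derivation_step N : deriv_level N -> log_derivation (x N.+1) (D N.+1).
Proof.
move=> [LD psi_emb]; have ON := G_ordered R N; have ON1 := G_ordered R N.+1.
have fM := embG_emb R N; have mx : mmem (x N) := xpow_mem N 1.
have mx1 : mmem (x N.+1) := xpow_mem N.+1 1.
(* The monomials of [x L'] are the [h * r] with [h] in [L] and [r] in [psi h]. *)
have psi_im (g : G R N.+1) q : mmem g -> psiG N.+1 g q != 0 ->
    q = 0 \/ exists h r, [/\ g.2 h != 0, psiG N h r != 0 & q = embG (h + r)].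
  move=> /G_mem[gg lg]; rewrite psi_GS.
  have [-> _|q0] := eqVneq q 0; first by left.
  rewrite mulr0 add0r => /fext_im[p /sext_neq0[h gh] + qE].
  have mh := gb_mem ON gg gh.
  rewrite (deriv_psi (x N) (D N)) => hp; right; exists h, (p - h + x N); split=> //.
  have -> : h + (p - h + x N) = p + x N by abel.
  have mr := psi_mem ON LD mh hp.
  have mp : mmem p.
    have -> : p = (p - h + x N) + h - x N by abel.
    by apply: (om_memB ON) => //; apply: memD.
  by rewrite (me_D ON fM) // embG_xpow -qE; abel.
have gb_psi (g : G R N.+1) : mmem g -> gb (psiG N.+1 g).
  move=> /G_mem[gg lg].
  have gS : gb (sext (D N) g.2) := sext_gb ON mx LD gg.
  have gE := gset_shift ON1 (fext_gb ON ON1 fM gS) mx1.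
  apply: gset_sub (gsetU ON1 (gset1 (om_mem0 ON1)) gE) => q.
  rewrite psi_GS; have [->|q0] := eqVneq q 0; first by left.
  by rewrite mulr0 add0r; right.
have psiB (g h : G R N.+1) : mmem g -> mmem h ->
    psiG N.+1 (g - h) = psiG N.+1 g - psiG N.+1 h.
  move=> /G_mem[gg lg] /G_mem[gh lh]; apply/funext => q.
  rewrite !serE !psi_GS -[(g - h).2]/(g.2 - h.2) -[(g - h).1]/(g.1 - h.1).
  rewrite (sextB ON LD) // !embE (fextB ON ON1 fM); first last.
  - exact: (sext_gb ON mx LD).
  - exact: (sext_gb ON mx LD).
  by rewrite !serE; ring.
have m0 : mmem (0 : G R N.+1) := om_mem0 ON1.
have psi00 : psiG N.+1 0 = 0 by rewrite -{1}(subrr 0) psiB // subrr.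
split=> //.
- move=> X [a [s [ma ss Xs]]].
  have ms (g : G R N.+1) : g \in a :: s -> mmem g.
    by rewrite inE => /orP[/eqP ->|/ss[]].
  have gL : gset (fun h : G R N => exists2 g : G R N.+1, g \in a :: s & g.2 h != 0).
    elim: (a :: s) ms => [|g t IHt] mt; first by apply: gset_sub (gset0 ON) => h [].
    have gg : gb g.2 by have [] := proj1 (G_mem g) (mt g (mem_head _ _)).
    have gt : gset (fun h : G R N => exists2 g : G R N.+1, g \in t & g.2 h != 0).
      by apply: IHt => k tk; apply: mt; rewrite inE tk orbT.
    apply: gset_sub (gsetU ON gg gt) => h [k].
    by rewrite inE => /orP[/eqP->|tk] kh; [left|right; exists k].
  have [Gam [ps [[memG G0 GB] LG gps sps]]] := ld_span LD gL.
  pose Y (g : G R N.+1) := g \in a :: s \/ exists2 h, Gam h & g = embG h.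
  have memY g : Y g -> mmem g.
    by move=> [/ms //|[h /memG mh ->]]; apply: (me_mem fM).
  pose qs := [seq psiG N.+1 g | g <- a :: s] ++ [seq emb p | p <- ps].
  exists (generated Y), qs; split.
  + exact: generated_subgroup.
  + move=> g /Xs[t st ->]; apply: generatedD.
      by apply: generated_in; left; rewrite mem_head.
    have sY y : y \in s -> Y y by move=> sy; left; rewrite inE sy orbT.
    exact: (generated_monoid sY st).
  + move=> p /In_cat[|] /In_map[g gin ->]; last first.
      have [gg Gg] := gps g gin; split; first exact: (fext_gb ON ON1 fM).
      by move=> q /fext_im[h gh ->]; apply: generated_in; right; exists h; auto.
    have sg : g \in a :: s by apply/In_mem.
    split=> [|q gq]; first exact/gb_psi/ms.
    have [->|[h [r [gh hr ->]]]] := psi_im g q (ms g sg) gq; first exact: generated0.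
    apply: generated_in; right; exists (h + r) => //.
    have Gh : Gam h by apply: LG; exists g.
    have [v psv vr] := span_supp (sps h Gh) hr.
    rewrite -[r]opprK; apply: (GB) => //; rewrite -sub0r; apply: (GB) => //.
    exact: (gps v psv).2.
  + move=> g Gg.
    suff [] : mmem g /\ span qs (psiG N.+1 g) by [].
    apply: (Gg (fun k => mmem k /\ span qs (psiG N.+1 k)))
      => [|h k [mh sh] [mk sk]|h [sh|[h' Gh' ->]]].
    * by rewrite psi00; split=> //; exact: span0.
    * by rewrite psiB //; split; [exact: om_memB|exact: spanB].
    * split; first exact: ms.
      by apply: span_in; apply/In_cat; left; apply/In_map; exists h => //; apply/In_mem.
    * have mh' := memG h' Gh'; split; first exact: (me_mem fM).
      rewrite psi_emb //; apply: span_cat; apply: (span_fext ON ON1 fM) => [p /gps[]|] //.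
      exact: sps.
- move=> g q mg g0 gq; have [gg lg] := proj1 (G_mem g) mg.
  have [->|[h [r [gh hr ->]]]] := psi_im g q mg gq; first by auto.
  have mh := gb_mem ON gg gh; have mr := psi_mem ON LD mh hr; have h0 := lg h gh.
  have [r0 rh] := ld_pos LD mh h0 hr.
  have hr0 : mlt 0 (h + r).
    by case: r0 => [->|r0]; rewrite ?addr0 //; apply: (om_posD ON).
  have mhr := memD ON mh mr.
  split; first by right; apply: (me_pos fM).
  apply: (mlt_trans ON1 _ _ mg _ (log_small 2 mg g0 gh)).
  + exact: (me_mem fM).
  + exact/(me_mem fM)/memMn.
  apply: (me_lt ON ON1 fM) => //; first exact: memMn.
  apply: (sub_pos ON); have -> : h *+ 2 - (h + r) = h - r by rewrite mulr2n; abel.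
  exact: (pos_sub ON).
- move=> g mg; have [gg lg] := proj1 (G_mem g) mg.
  have [g20 g_neq0|nz] := pselect (g.2 = 0).
    exists 0; rewrite psi_GS eqxx mulr1 g20.
    have -> : sext (D N) 0 = 0.
      by have := sextB ON LD (gb0 ON) (gb0 ON); rewrite !subrr.
    rewrite embE (fext0 ON ON1 fM) -[_ + _]/(g.1 + 0) addr0.
    apply: contraNneq g_neq0; case: g g20 {mg gg lg} => b L /= -> ->.
    exact: eqxx.
  have [l magl] : exists l, is_mag g.2 l.
    apply: (mag_exists ON gg); apply: contrapT => nex; apply: nz; apply/funext => h.
    by apply: contrapT => /eqP gh; apply: nex; exists h.
  move=> _; have ml := gb_mem ON gg magl.1; have l0 := lg l magl.1.
  have [m magm] := psi_mag ON LD ml (pos_neq0 ON l0).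
  have mm := psi_mem ON LD ml magm.1.
  exists (embG (l + m)); rewrite psi_GS.
  have lm0 : mlt 0 (embG (l + m) : G R N.+1).
    apply: (me_pos fM); first exact: memD.
    case: (psi_ge0 ON LD ml magm.1) => [->|m_gt0]; first by rewrite addr0.
    exact: (om_posD ON).
  rewrite (negPf (pos_neq0 ON1 lm0)) mulr0 add0r -embG_xpow.
  rewrite -(me_B fM) //; last exact: memD.
  rewrite embE (fextE ON ON1 fM (sext_gb ON mx LD gg)); last first.
    by apply: (om_memB ON) => //; apply: memD.
  exact: sext_mag.
Qed.

Lemma deriv_levelP N : deriv_level N.
Proof.
elim: N => [|N IHN]; split.
- have OG0 := G_ordered R 0.
  split=> [g h _ _|X gX|g q _ g0|g _ g0].
  + by apply/funext => q; rewrite !serE !psi_G0 -mulrBl.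
  + exists (fun=> True), [:: mono 0]; split=> //.
      move=> p [<-|//]; split=> //; exact: gb_mono.
    move=> g _; exists g; apply/funext => q.
    by rewrite !serE psi_G0 subrr.
  + rewrite psi_G0 mulf_eq0 negb_or => /andP[_].
    by have [->|] := eqVneq q 0; [split=> //; left|rewrite eqxx].
  + by exists 0; rewrite psi_G0 eqxx mulr1.
- move=> g _; have OG0 := G_ordered R 0; have OG1 := G_ordered R 1.
  have fM := embG_emb R 0; have sext0 : sext (D 0) (0 : gseries (G R 0)) = 0.
    by apply/funext => h; rewrite sextE; apply: fsbig1 => k _; rewrite mul0r.
  have psiE q : psiG 1 (embG g) q = g * (q == 0)%:R.
    rewrite psi_GS sext0 embE (fext0 OG0 OG1 fM).
    exact: addr0.
  apply/esym/(fextP OG0 OG1 fM) => [|p _|k].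
  + apply: gset_sub (gset1 (om_mem0 OG0)) => q; rewrite psi_G0.
    by have [->|] := eqVneq q 0; rewrite ?mulr0 ?eqxx.
  + rewrite psiE psi_G0; congr (_ * _%:R).
    by congr nat_of_bool; apply/eqP/eqP => [[]|->].
  + rewrite psiE; have [-> _|] := eqVneq k 0; last by rewrite mulr0 eqxx.
    by exists 0.
- exact: log_derivation_step.
- have LD1 := log_derivation_step IHN; have [LD _] := IHN.
  have ON := G_ordered R N; have ON1 := G_ordered R N.+1.
  have ON2 := G_ordered R N.+2; have fM := embG_emb R N; have fM1 := embG_emb R N.+1.
  have mx : mmem (x N) := xpow_mem N 1; have mx1 : mmem (x N.+1) := xpow_mem N.+1 1.
  move=> g mg; have [gg lg] := proj1 (G_mem g) mg.
  have psiE q : psiG N.+2 (embG g) q = g.1 * (q == 0)%:R +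
      fext (@embG R N.+1) (emb (sext (D N) g.2)) (q - x N.+2).
    by rewrite psi_GS -[(embG g).2]/(emb g.2) sext_emb.
  have gE : gb (emb (sext (D N) g.2)).
    exact: (fext_gb ON ON1 fM (sext_gb ON mx LD gg)).
  apply/esym/(fextP ON1 ON2 fM1) => [|p mp|k].
  + exact: (psi_gb ON1 LD1 mg).
  + rewrite psiE psi_GS -embG_xpow -(me_B fM1) // (fextE ON1 ON2 fM1) //; last first.
      exact: (om_memB ON1).
    congr (_ * (nat_of_bool _)%:R + _); apply/eqP/eqP => [|->]; last exact: (me_0 ON1 fM1).
    rewrite -(me_0 ON1 fM1); exact: (me_inj ON1 ON2 fM1 mp (om_mem0 ON1)).
  + rewrite psiE; have [-> _|_] := eqVneq k 0.
      exists 0; [exact: om_mem0 ON1|exact/esym/(me_0 ON1 fM1)].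
    rewrite mulr0 add0r => /fext_im[p pE kE]; have mp := gb_mem ON1 gE pE.
    exists (p + x N.+1); first exact: memD.
    by rewrite (me_D ON1 fM1) // embG_xpow -kE; abel.
Qed.

End Levels.

(** * Composition with the exponential *)

Section PowersOfMonomials.
Variables (R : realType) (M : monomials R).
Hypothesis OM : ordered_monomials M.
Implicit Types (g h : M).

Lemma smul_mono g h : smul (mono g) (mono h) = mono (g + h) :> gseries M.
Proof.
apply/funext => k; rewrite smul_monol /mono; congr (nat_of_bool _)%:R.
by rewrite subr_eq addrC.
Qed.

Lemma sexpn0S j : sexpn (0 : gseries M) j.+1 = 0.
Proof.
by apply/funext => g; rewrite /sexpn /= /smul; apply: fsbig1 => k _; rewrite mul0r.
Qed.

(** Only powers of monomials and exponentials of purely large series are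
    needed; their binomial and exponential series are those of 0. *)
Lemma ssum_sexpn0 (c : nat -> R) : c 0%N = 1 ->
  ssum (fun j => c j *: sexpn (0 : gseries M) j) = mono 0.
Proof.
move=> c0; apply/funext => g; rewrite /ssum (fsum_single (i0 := 0%N)).
  by rewrite serZ c0 mul1r.
by case=> // j _; rewrite sexpn0S serZ mulr0.
Qed.

Lemma spow_mono g (b : R) : spow (mono g) b = mono (b *: g).
Proof.
rewrite /spow (@xget_unique _ _ _ (1, g, 0)).
- rewrite powR1 scale1r ssum_sexpn0 ?smul_mono ?addr0 //.
  by rewrite /gbinom big_ord0 fact0 divr1.
- split=> [|k|] /=; first exact: ltr01.
    by move/eqP.
  by rewrite addr0 scale1r smul_mono addr0.
(* The small part has no constant term, so the decomposition is read off from
   the coefficient at [g'], where the other side is nonzero only if [g' = g]. *)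
- move=> [[c g'] U] [/= c0 sU gE].
  have U0 : U 0 = 0 by apply/eqP/negPn/negP => /sU /(mltxx OM).
  have E k : (mono g : gseries M) k = c * ((mono 0 : gseries M) (k - g') + U (k - g')).
    by rewrite gE serZ smul_monol serD.
  have := E g'; rewrite subrr U0 monoE addr0 mulr1 => cE.
  have g'g : g' = g.
    by apply: mono_neq0; rewrite cE gt_eqF.
  subst g'; move: cE; rewrite monoE => c1; subst c; congr (_, _, _).
  apply/funext => k; have := E (k + g); rewrite mul1r addrK.
  have -> : (mono g : gseries M) (k + g) = (mono 0 : gseries M) k.
    by rewrite /mono -subr_eq0 addrK.
  by move=> kE; apply: (addrI ((mono 0 : gseries M) k)); rewrite -kE addr0.
Qed.

End PowersOfMonomials.

Section CompositionExp.
Variable R : realType.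
Implicit Types (N : nat).

Lemma sexp_purely_large N (L : gseries (G R N)) :
  purely_large L -> sexp L = mono (emon L).
Proof.
move=> lL; have ON := G_ordered R N; rewrite /sexp (@xget_unique _ _ _ (L, 0, 0)).
- rewrite expR0 scale1r ssum_sexpn0 ?fact0 ?invr1 //.
  rewrite embE (fext_mono ON (G_ordered R N.+1) (embG_emb R N) (om_mem0 ON)).
  by rewrite (me_0 ON (embG_emb R N)) smul_mono addr0.
- by split=> [|k|] //=; [move/eqP|rewrite scale0r !addr0].
- move=> [[L' c] U] [/= lL' sU LE].
  have E k : L k = L' k + c * (mono 0 : gseries (G R N)) k + U k.
    by rewrite LE !serE.
  have small0 (T : gseries (G R N)) k : small T -> ~ mlt k 0 -> T k = 0.
    by move=> sT nk; apply/eqP/negPn/negP => /sT.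
  have large0 (T : gseries (G R N)) k : purely_large T -> ~ mlt 0 k -> T k = 0.
    by move=> lT nk; apply/eqP/negPn/negP => /lT.
  have c0 : c = 0.
    have := E 0; rewrite monoE (small0 U) // ?(large0 L) // ?(large0 L') //;
      try exact: (mltxx ON).
    by rewrite add0r addr0 mulr1.
  subst c; have EU k : L k = L' k + U k by rewrite E mul0r addr0.
  have [LE' UE] : L' = L /\ U = 0; last by rewrite LE' UE.
  split; apply/funext => k; have := EU k.
    have [k0|nk0] := pselect (mlt 0 k).
      by rewrite (small0 U k) ?addr0 // => k0'; apply: (mlt_asym ON k0).
    by rewrite (large0 L' k) // (large0 L k).
  have [k0|nk0] := pselect (mlt 0 k).
    by move=> _; rewrite (small0 U k) // => k0'; apply: (mlt_asym ON k0).
  by rewrite (large0 L' k) // (large0 L k) // add0r.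
Qed.

Lemma xpow_pos N : mlt 0 (xpow N 1 : G R N).
Proof.
case: N => [|N]; first exact: ltr01.
by apply/G_pos; right; split=> //; exact: ltr01.
Qed.

Lemma sx_purely_large N : purely_large (sx N : gseries (G R N)).
Proof. by move=> k /mono_neq0 ->; apply: xpow_pos. Qed.

Lemma sx_gb N : gb (sx N : gseries (G R N)).
Proof. exact/gb_mono/xpow_mem. Qed.

Lemma emon_mem N (L : gseries (G R N)) : gb L -> purely_large L -> mmem (emon L).
Proof. by move=> gL lL; apply/G_mem. Qed.

Lemma emon_pos N (L : gseries (G R N)) : spos L -> mlt 0 (emon L).
Proof. by move=> pL; apply/G_pos; left. Qed.

Lemma emonB N (L K : gseries (G R N)) : emon (L - K) = emon L - emon K.
Proof. by rewrite -[RHS]/(0 - 0, L - K) subrr. Qed.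

Lemma xlog_mem N (b : R) : mmem (@emon R N (b *: sx N)).
Proof.
apply: emon_mem; first exact/gbZ/sx_gb.
exact/purely_largeZ/sx_purely_large.
Qed.

(** The substitution of [e^x] for [x] in the monomials: [x^b e^L] becomes the
    exponential of [b x + L o exp], which is purely large. *)
Fixpoint compE N : G R N -> G R (N + 1) :=
  if N is N'.+1 return G R N -> G R (N + 1)
  then fun g => @emon R (N' + 1) (g.1 *: sx (N' + 1) + fext (@compE N') g.2)
  else fun b => @emon R 0 ((b : R) *: sx 0).

(** As [g o exp] exceeds [x] for every large [g], the term [L o exp] prevails
    over [b x]. *)
Lemma compE_emb N : monomial_emb (@compE N) /\
  forall g, mmem g -> mlt 0 g -> mlt (xpow (N + 1) 1) (compE g).
Proof.
elim: N => [|N [fM IHN]].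
  have pos b : 0 < b -> spos (b *: sx 0 : gseries (G R 0)).
    move=> b0; exists 1; rewrite /is_mag serZ /sx monoE mulr1; split=> //.
    split=> [|h]; first by rewrite gt_eqF.
    by rewrite serZ mulf_eq0 negb_or => /andP[_ /mono_neq0].
  split; first split=> [b _|b c _ _|b _ b0].
  - exact: (@xlog_mem 0 b).
  - by rewrite /compE scalerBl emonB.
  - by apply: (@emon_pos 0); apply: pos.
  - by move=> b _ b0; left; rewrite subr0; apply: pos.
have ON := G_ordered R N; have ON1 := G_ordered R (N + 1).
have spos_comp (g : G R N.+1) : mmem g -> mlt 0 g ->
    spos (g.1 *: sx (N + 1) + fext (@compE N) g.2).
  move=> /G_mem[gg lg] /G_pos[[m [magm m0]]|[-> g1]].
    rewrite addrC; apply: (spos_dominant ON1 (fext_mag ON ON1 fM gg magm)).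
      by rewrite (fextE ON ON1 fM) //; apply: gb_mem magm.1.
    move=> h; rewrite serZ mulf_eq0 negb_or => /andP[_ /mono_neq0 ->].
    apply: IHN; last exact/lg/magm.1.
    exact: gb_mem magm.1.
  rewrite (fext0 ON ON1 fM) addr0; exists (xpow (N + 1) 1).
  rewrite /is_mag serZ /sx monoE mulr1; split=> //.
  split=> [|h]; first by rewrite gt_eqF.
  by rewrite serZ mulf_eq0 negb_or => /andP[_ /mono_neq0].
split; first split=> [g|g h|g mg g0].
- move=> /G_mem[gg lg]; apply: (@emon_mem (N + 1)).
    apply: (gbD ON1); first exact/gbZ/sx_gb.
    exact: fext_gb.
  apply: purely_largeD; first exact/purely_largeZ/sx_purely_large.
  exact: fext_purely_large.
- move=> /G_mem[gg lg] /G_mem[gh lh].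
  rewrite -[LHS]/(@emon R (N + 1)
    ((g.1 - h.1) *: sx (N + 1) + fext (@compE N) (g.2 - h.2))).
  rewrite (fextB ON ON1 fM) // -[RHS]emonB; congr emon.
  by apply/funext => k; rewrite !serE; ring.
- by apply: (@emon_pos (N + 1)); apply: spos_comp.
- by move=> g mg g0; left; rewrite subr0; apply: spos_comp.
Qed.

Lemma embn_emon_x N (b : R) :
  @embn R N 1 (mono (@emon R 0 (b *: sx 0))) =
  mono (if N is N'.+1 return G R (N + 1) then @emon R (N' + 1) (b *: sx (N' + 1))
        else @emon R 0 (b *: sx 0)).
Proof.
have embG_b n : embG (@emon R n (b *: sx n)) = @emon R n.+1 (b *: sx n.+1).
  rewrite /emon /=; congr pair.
  have ON := G_ordered R n; have ON1 := G_ordered R n.+1.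
  rewrite -[LHS]/(fext _ _) (fextZ ON ON1 (embG_emb R n)); last exact: sx_gb.
  by rewrite (fext_mono ON ON1 (embG_emb R n)) ?embG_xpow //; apply: xpow_mem.
elim: N => // N IHN; rewrite [LHS]/= IHN embE.
rewrite (fext_mono (G_ordered R _) (G_ordered R _) (embG_emb R _)).
  by case: N {IHN} => [|N]; congr mono; apply: embG_b.
by case: N {IHN} => [|N]; apply: xlog_mem.
Qed.

Lemma eq_sext (M M' : monomials R) (F F' : M -> gseries M') (T : gseries M) :
  (forall g, T g != 0 -> F g = F' g) -> sext F T = sext F' T.
Proof.
move=> FF'; apply/funext => k; rewrite /sext /ssum; apply: eq_fsbigr => g _.
by rewrite !serZ; have [->|/FF' ->] := eqVneq (T g) 0; rewrite ?mul0r.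
Qed.

Lemma compG_exp N (g : G R N) : mmem g ->
  compG (sexp (sx 0)) g = mono (compE g).
Proof.
have expx : sexp (sx 0) = mono (@emon R 0 (sx 0)).
  exact/sexp_purely_large/sx_purely_large.
have powx b : spow (sexp (sx 0)) b = mono (@emon R 0 (b *: sx 0)).
  rewrite expx (spow_mono (G_ordered R 1)); congr mono.
  by rewrite -[LHS]/(b *: (0 : R^o), b *: sx 0) scaler0.
elim: N g => [|N IHN] g; first by move=> _; rewrite -powx.
move=> /G_mem[gg lg]; have ON := G_ordered R N; have ON1 := G_ordered R (N + 1).
have [fM _] := compE_emb N.
rewrite [LHS]/= powx -[emb _]/(@embn R N.+1 1 _) embn_emon_x.
rewrite (_ : sext _ g.2 = fext (@compE N) g.2); last first.
  by apply: eq_sext => h gh; apply: IHN; apply: gb_mem gh.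
rewrite sexp_purely_large; last exact: fext_purely_large.
by rewrite smul_mono; congr mono; rewrite /= /emon -[LHS]/(0 + 0, _) addr0.
Qed.

Lemma comp_expE N (T : gseries (G R N)) : gb T -> comp_exp T = fext (@compE N) T.
Proof.
move=> gT; apply: eq_sext => g Tg; apply: compG_exp.
exact: (gb_mem (G_ordered R N) gT Tg).
Qed.

Definition xdeg N : G R N -> R :=
  if N is N'.+1 return G R N -> R then fun g => g.1 else fun g => g.

Lemma xdegD N (g h : G R N) : xdeg (g + h) = xdeg g + xdeg h.
Proof. by case: N g h. Qed.

Lemma xdegB N (g h : G R N) : xdeg (g - h) = xdeg g - xdeg h.
Proof. by case: N g h. Qed.

Lemma xdeg_embG N (g : G R N) : xdeg (embG g) = xdeg g.
Proof. by case: N g. Qed.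

Lemma xdeg_compE N (g : G R N) : xdeg (compE g) = 0.
Proof. by case: N g. Qed.

End CompositionExp.

(** * Iterated exponentials *)

Local Notation embs n := (@embn _ n _).

Section IteratedExp.
Variable R : realType.
Implicit Types (N : nat).

(** The [j]-th iterated exponential of [x], for [j <= N]. *)
Fixpoint expG (j N : nat) : G R N :=
  if j is j'.+1 then
    if N is N'.+1 return G R N then emon (mono (expG j' N')) else 0
  else xpow N 1.

Lemma expG_mem_pos j N : (j <= N)%N -> mmem (expG j N) /\ mlt 0 (expG j N).
Proof.
elim: j N => [|j IHj] N; first by split; [exact: xpow_mem|exact: xpow_pos].
case: N => // N /IHj[mj pj]; split.
  by apply: emon_mem; [exact: gb_mono|move=> k /mono_neq0 ->].
apply: emon_pos; exists (expG j N); rewrite /is_mag monoE; split=> //.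
by split=> [|h /mono_neq0 ->]; rewrite ?oner_neq0.
Qed.

Lemma embG_expG j N : (j <= N)%N -> embG (expG j N) = expG j N.+1.
Proof.
elim: j N => [|j IHj] N; first by rewrite embG_xpow.
case: N => // N jN; have [mj _] := @expG_mem_pos j N jN.
rewrite [expG j.+1 N.+2]/= -IHj //.
by rewrite -(fext_mono (G_ordered R N) (G_ordered R N.+1) (embG_emb R N)).
Qed.

Lemma expn_xE N m : expn_x N m = mono (expG m (m + N)) :> gseries (G R (m + N)).
Proof.
elim: m => // m IHm; rewrite [LHS]/= IHm sexp_purely_large //.
by move=> k /mono_neq0 ->; apply: (expG_mem_pos _).2; apply: leq_addr.
Qed.

Lemma sexp_expn_x N m : sexp (- expn_x N m) = mono (- expG m.+1 (m.+1 + N)).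
Proof.
rewrite expn_xE sexp_purely_large; last first.
  move=> k; rewrite serN oppr_eq0 => /mono_neq0 ->.
  by apply: (expG_mem_pos _).2; apply: leq_addr.
by rewrite -[in LHS]sub0r emonB sub0r.
Qed.

Fixpoint embGn n N : G R N -> G R (n + N) :=
  if n is n'.+1 return G R N -> G R (n + N) then fun g => embG (@embGn n' N g)
  else id.

Lemma embGn_mem n N (g : G R N) : mmem g -> mmem (embGn n g).
Proof. by move=> mg; elim: n => //= n; apply: (me_mem (embG_emb R _)). Qed.

Lemma embGn_expG n j N : (j <= N)%N -> embGn n (expG j N) = expG j (n + N).
Proof.
move=> jN; elim: n => // n IHn; rewrite [LHS]/= IHn embG_expG //.
exact: leq_trans jN (leq_addl _ _).
Qed.

Lemma embn_gb n N (T : gseries (G R N)) : gb T -> gb (embs n T).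
Proof.
move=> gT; elim: n => // n.
exact: (fext_gb (G_ordered R _) (G_ordered R _) (embG_emb R _)).
Qed.

Lemma embn_shift n N (T : gseries (G R N)) q : gb T -> mmem q ->
  embs n (smul T (mono q)) = smul (embs n T) (mono (embGn n q)).
Proof.
move=> gT mq; elim: n => // n IHn; rewrite [LHS]/= IHn.
have [ON ON1] := (G_ordered R (n + N), G_ordered R (n + N).+1).
have fM := embG_emb R (n + N); have gn := embn_gb n gT; have mn := embGn_mem n mq.
have gTq : gb (smul (embs n T) (mono (embGn n q))).
  apply: gset_sub (gset_shift ON gn mn) => g; by rewrite smul_monor.
apply: (fextP ON ON1 fM) => // [g mg|k]; rewrite !smul_monor.
  rewrite -[embs n.+1 T]/(fext (@embG R (n + N)) (embs n T)) -(me_B fM) //.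
  by rewrite (fextE ON ON1 fM) //; apply: (om_memB ON).
move=> /fext_im[g gn0 kE]; have mg := gb_mem ON gn gn0.
exists (g + embGn n q); first exact: memD.
by rewrite (me_D ON fM) // -kE subrK.
Qed.

(** By the chain rule, each further logarithm divides the derivative by one more
    iterated exponential, which cancels one factor of the product. *)
Lemma deriv_log_expG N n (S V : gseries (G R N)) : (n <= N)%N -> gb V ->
  sderiv S = smul V (mono (\sum_(0 <= j < n) expG j.+1 N)) ->
  deriv_log N n S = embs n V.
Proof.
move=> nN gV SV; have ON := G_ordered R N.
have mem_sum m : (m <= n)%N -> mmem (\sum_(m <= j < n) expG j.+1 N).
  move=> mn; rewrite big_nat; elim/big_ind: _ => [||j /andP[_ jn]].
  - exact: om_mem0 ON.
  - by move=> g h; apply: memD.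
  - by apply: (expG_mem_pos _).1; apply: leq_trans nN.
suff H m : (m <= n)%N -> deriv_log N m S =
    embs m (smul V (mono (\sum_(m <= j < n) expG j.+1 N))).
  rewrite H // big_geq //; congr (embs n _); apply/funext => g.
  by rewrite smul_monor subr0.
elim: m => // m IHm mn; rewrite [LHS]/= IHm ?(ltnW mn) // sexp_expn_x.
rewrite -[emb (embs m _)]/(embs m.+1 _) (big_ltn mn).
set e := expG m.+1 N; set r := \sum_(_ <= _ < _) _.
have me : mmem e := (expG_mem_pos (leq_trans mn nN)).1.
have mr : mmem r := mem_sum _ mn.
have -> : smul V (mono (e + r)) = smul (smul V (mono r)) (mono e).
  by apply/funext => g; rewrite !smul_monor opprD addrA.
have gVr : gb (smul V (mono r)).
  by apply: gset_sub (gset_shift ON gV mr) => g; rewrite smul_monor.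
rewrite (embn_shift _ gVr me) (embGn_expG m.+1 (leq_trans mn nN)).
by apply/funext => g; rewrite !smul_monor opprK addrK.
Qed.

Lemma teq_embn M n N (T : gseries (G R N)) : gb T ->
  teq (TExpr M T) (TExpr M (embs n T)).
Proof.
move=> gT; elim: n => [|n IHn]; first exact: teq_refl.
apply: teq_trans IHn _; apply: teq_emb.
exact/(grid_basedP (G_ordered R _))/embn_gb.
Qed.

Lemma xdeg_expG j N : xdeg (expG j.+1 N) = 0.
Proof. by case: N. Qed.

Lemma xdeg_embn n N (T : gseries (G R N)) g :
  (forall h, T h != 0 -> xdeg h = 0) -> embs n T g != 0 -> xdeg g = 0.
Proof.
move=> T0; elim: n g => [|n IHn] g; first exact: T0.
by move=> /fext_im[h /IHn h0 ->]; rewrite xdeg_embG.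
Qed.

End IteratedExp.

(** * Integration of transseries *)

Theorem theorem4p29 (R : realType) (A : texpr R) (hA : transseries A) :
  exists B : texpr R, transseries B /\ teq (tderiv B) A.
Proof.
case: A hA => M N T /(grid_basedP (G_ordered R N)) gT.
have ON := G_ordered R N; have ON1 := G_ordered R (N + 1).
have [fM _] := compE_emb R N.
(* The height [K] makes room for the exponentials up to [exp_(M+1) x]. *)
pose K := (M.+1 + (N + 1))%N; have OK := G_ordered R K.
have gTE : gb (comp_exp T) by rewrite comp_expE //; apply: (fext_gb ON ON1 fM).
pose V : gseries (G R K) := embs M.+1 (comp_exp T).
have gV : gb V by apply: embn_gb.
have degV g : V g != 0 -> xdeg g = 0.
  apply: xdeg_embn => h; rewrite comp_expE // => /fext_im[k _ ->].
  exact: xdeg_compE.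
have MK : (M.+1 <= K)%N by apply: leq_addr.
pose q : G R K := \sum_(0 <= j < M.+1) expG R j.+1 K.
have [mq q0] : mmem q /\ xdeg q = 0.
  rewrite /q big_nat; elim/big_ind: _ => [||j /andP[_ jM]].
  - by split; [exact: om_mem0 OK|].
  - move=> g h [mg g0] [mh h0]; split; first exact: memD.
    by rewrite xdegD g0 h0 addr0.
  - split; last exact: xdeg_expG.
    by apply: (expG_mem_pos _ _).1; apply: leq_trans MK.
have gW : gb (smul V (mono q)).
  by apply: gset_sub (gset_shift OK gV mq) => g; rewrite smul_monor.
have [LD _] := deriv_levelP R K.
have [|S gS SE] := integral_exists OK (xpow_mem K 1) LD gW.
  (* [x^-1] occurs in [W] only if some monomial of [V] has [x]-exponent -1. *)
  rewrite smul_monor; apply/eqP/negPn/negP => /degV; rewrite xdegB q0 subr0.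
  have -> : xdeg (- xpow K 1 : G R K) = -1 by [].
  by move/eqP; rewrite oppr_eq0 oner_eq0.
exists (TExpr M.+1 S); split; first exact/(grid_basedP OK).
have -> : tderiv (TExpr M.+1 S) = TExpr M.+1 (embs M.+1 V).
  by rewrite -(deriv_log_expG MK gV SE).
apply: teq_trans (teq_sym (teq_embn _ _ gV)) _.
apply: teq_trans (teq_sym (teq_embn _ _ gTE)) _.
exact/teq_sym/teq_exp/(grid_basedP ON).
Qed.
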